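(* Let $\mathcal V$ be the algebra of difference polynomials in the variables $u_i$, $i\in\mathbb Z_{\le0}$, and let $L(S)=S+\sum_{i\le0}u_iS^i\in\mathcal V((S^{-1}))$ be the pseudodifference operator of generic type of order $N=1$. Endow $\mathcal V$ with the (local) multiplicative Poisson vertex algebra structure given, for $i,j\le0$, by $$\{{u_i}_\lambda u_j\}_2^{(L)D}=\sum_{n=0}^{1-i}\big(u_{j-n}(\lambda S)^{j-i-n}u_{i+n}-u_{i+n}(\lambda S)^nu_{j-n}\big)+u_j\big(\lambda S-(\lambda S)^j\big)\big(\lambda S-1\big)^{-1}\big(1-(\lambda S)^{-i}\big)u_i,$$ where $u_1=1$ and $u_k=0$ for $k>1$. Let $h_n=-\frac1n\,\mathrm{mRes}_zL^n(z)$ for $n\ge1$ and $h_0=0$. Then $$\frac{dL(w)}{dt_n}=\{\textstyle\int h_n,L(w)\}_2^{(L)D}=[(L^n)_+,L](w),\qquad n\in\mathbb Z_{\ge0},$$ is an integrable hierarchy of Hamiltonian equations in $\mathcal V$.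
   Context: The base field $\mathbb F$ has characteristic $0$. The algebra of difference polynomials in variables $u_i$ is the polynomial algebra in independent variables $S^k(u_i)$, $k\in\mathbb Z$, with shift automorphism $S$. A multiplicative Poisson vertex algebra (mPVA) is a unital commutative associative algebra $\mathcal V$ with automorphism $S$ and a linear map $\mathcal V\otimes\mathcal V\to\mathcal V[\lambda,\lambda^{-1}]$, $a\otimes b\mapsto\{a_\lambda b\}$, with: $\{S(a)_\lambda b\}=\lambda^{-1}\{a_\lambda b\}$, $\{a_\lambda S(b)\}=\lambda S\{a_\lambda b\}$; $\{a_\lambda bc\}=\{a_\lambda b\}c+\{a_\lambda c\}b$; $\{ab_\lambda c\}=\sum_n(p_nS^n(b)+q_nS^n(a))\lambda^n$ where $\{a_\lambda c\}=\sum_np_n\lambda^n$, $\{b_\lambda c\}=\sum_nq_n\lambda^n$; $\{b_\lambda a\}=-\sum_nS^{-n}(c_n)\lambda^{-n}$ if $\{a_\lambda b\}=\sum_nc_n\lambda^n$; $\{a_\lambda\{b_\mu c\}\}-\{b_\mu\{a_\lambda c\}\}=\{\{a_\lambda b\}_{\lambda\mu}c\}$. The values on generators extend uniquely to $\mathcal V$ by sesquilinearity and the Leibniz rules. In the bracket formula $S$ acts on what is written to its right ($u_a(\lambda S)^mu_b=u_aS^m(u_b)\lambda^m$), and $(x-1)^{-1}(1-x^{-i})$ is a Laurent polynomial in $x=\lambda S$. Hamiltonian functionals are elements of $\mathcal V/(S-1)\mathcal V$, with quotient map $\int$; $\{\int a,\int b\}=\int\{a_\lambda b\}|_{\lambda=1}$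 is a Lie bracket and $\{\int a,b\}=\{a_\lambda b\}|_{\lambda=1}$ an action by derivations of $\mathcal V$ commuting with $S$. The Hamiltonian equation of $\int h$ is $\frac{du}{dt}=\{\int h,u\}$, $u\in\mathcal V$; it is integrable if it has infinitely many linearly independent integrals of motion in involution $\int h_n$ (including $\int h$), i.e. $\{\int h_m,\int h_n\}=0$ for all $m,n$; the equations $\frac{du}{dt_n}=\{\int h_n,u\}$ then form an integrable hierarchy. (Here the linearly independent functionals are $\int h_n$, $n\ge1$.) $\mathcal V((S^{-1}))$ has coefficients on the left and product determined by $S\circ f=S(f)S$. For $A(S)=\sum_na_nS^n$: symbol $A(z)=\sum_na_nz^n$, $A_+=\sum_{n\ge0}a_nS^n$, $\mathrm{mRes}_zA(z)=a_0$; $L^n(z)$ is the symbol of the $n$-th power of $L(S)$ and $[A,B](w)$ the symbol of the commutator. *)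

(* Defs.v *)
From mathcomp Require Import all_boot all_order all_algebra finmap.
From mathcomp Require Export monalg.

Set Implicit Arguments.
Unset Strict Implicit.
Unset Printing Implicit Defensive.

Import Order.TTheory GRing.Theory Num.Theory.
Local Open Scope ring_scope.

Section MultiplicativePVA.
Variables (F : fieldType) (V : comAlgType F).

(* An automorphism S is given through all its powers: S n is the n-th power,  *)
(* for n : int.  A Laurent polynomial sum_n c_n lambda^n with coefficients in *)
(* V is an element of {malg V[int]}, and c_n is its coefficient @_n.          *)
Variables (S : int -> V -> V) (br : V -> V -> {malg V[int]}).

Record is_aut_powers : Prop := IsAutPowers {
  aut_linear : forall n (c : F) a b, S n (c *: a + b) = c *: S n a + S n b;
  aut_one : forall n, S n 1 = 1;
  aut_mul : forall n a b, S n (a * b) = S n a * S n b;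
  aut_pow0 : forall a, S 0 a = a;
  aut_powD : forall m n a, S (m + n) a = S m (S n a)
}.

(* All identities are written on the coefficient of lambda^n, and the Jacobi  *)
(* identity on that of lambda^m mu^n: in {{a_lambda b}_{lambda mu} c}, the    *)
(* coefficient c_k of lambda^k in {a_lambda b} contributes                    *)
(* lambda^k {(c_k)_{lambda mu} c}.                                            *)
Record is_mPVA : Prop := IsMPVA {
  mpva_aut : is_aut_powers;
  mpva_linearl : forall (k : F) a b c n,
    (br (k *: a + b) c)@_n = k *: (br a c)@_n + (br b c)@_n;
  mpva_linearr : forall (k : F) a b c n,
    (br a (k *: b + c))@_n = k *: (br a b)@_n + (br a c)@_n;
  mpva_sesquil : forall a b n, (br (S 1 a) b)@_n = (br a b)@_(n + 1)%R;
  mpva_sesquir : forall a b n, (br a (S 1 b))@_n = S 1 ((br a b)@_(n - 1)%R);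
  mpva_leibnizr : forall a b c n,
    (br a (b * c))@_n = (br a b)@_n * c + (br a c)@_n * b;
  mpva_leibnizl : forall a b c n,
    (br (a * b) c)@_n = (br a c)@_n * S n b + (br b c)@_n * S n a;
  mpva_skew : forall a b n, (br b a)@_n = - S n ((br a b)@_(- n)%R);
  mpva_jacobi : forall a b c m n,
    (br a ((br b c)@_n))@_m - (br b ((br a c)@_m))@_n
    = (br ((br a b)@_(m - n)%R) c)@_n
}.

Definition at_lambda1 (P : {malg V[int]}) : V := \sum_(n <- msupp P) P@_n.

(* The right-hand side {\int h, u} of the Hamiltonian equation of \int h.     *)
Definition ham_eq (h u : V) : V := at_lambda1 (br h u).

(* \int a = 0 in the quotient V / (S - 1) V.                                  *)
Definition int_eq0 (a : V) : Prop := exists c : V, a = S 1 c - c.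

Definition int_linindep (h : nat -> V) : Prop :=
  forall (N : nat) (c : 'I_N -> F),
    int_eq0 (\sum_(n < N) c n *: h n) -> forall n, c n = 0.

Definition in_involution (h : nat -> V) : Prop :=
  forall m n, int_eq0 (at_lambda1 (br (h m) (h n))).

(* Only h_1, h_2, ... are required to be independent: h_0 = 0 below.          *)
Definition integrable_hierarchy (h : nat -> V) : Prop :=
  in_involution h /\ int_linindep (fun n => h n.+1).

(* PDO N a is the pseudodifference operator sum_(k >= 0) a_k S^(N - k).  As   *)
(* a_0 may vanish, N is only an upper bound for the order, and two operators  *)
(* are equal when all their coefficients pdo_coef are.                        *)
Record pdo := PDO { pdo_top : int; pdo_seq : nat -> V }.

Definition pdo_coef (A : pdo) (n : int) : V :=
  if n <= pdo_top A then pdo_seq A `|pdo_top A - n|%N else 0.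

Definition pdo_one : pdo := PDO 0 (fun k => (k == 0%N)%:R).

Definition pdo_mul (A B : pdo) : pdo :=
  PDO (pdo_top A + pdo_top B)
      (fun k => \sum_(p < k.+1)
         pdo_seq A p * S (pdo_top A - p%:Z) (pdo_seq B (k - p)%N)).

Definition pdo_sub (A B : pdo) : pdo :=
  let N := Num.max (pdo_top A) (pdo_top B) in
  PDO N (fun k => pdo_coef A (N - k%:Z) - pdo_coef B (N - k%:Z)).

Definition pdo_exp (A : pdo) (n : nat) : pdo := iter n (pdo_mul A) pdo_one.

Definition pdo_comm (A B : pdo) : pdo := pdo_sub (pdo_mul A B) (pdo_mul B A).

Definition pdo_plus (A : pdo) : pdo :=
  PDO (pdo_top A) (fun k => if 0 <= pdo_top A - k%:Z then pdo_seq A k else 0).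

Definition mRes (A : pdo) : V := pdo_coef A 0.

End MultiplicativePVA.

(* Polynomials in the independent variables S^m(u_i), i <= 0, m in Z; the     *)
(* variable of index (k, m) : nat * int is S^m(u_{-k}).                       *)
Notation diffpoly F := {malg F[{cmonom (nat * int)%type}]}.

Section GenericOrderOne.
Variable F : fieldType.

Definition dvar (x : nat * int) : diffpoly F := << ucm x >>.

(* S^n, the substitution S^m(u_i) |-> S^(m + n)(u_i).                         *)
Definition shift (n : int) (p : diffpoly F) : diffpoly F :=
  mmap (fun c : F => c%:A : diffpoly F)
    (fun m : {cmonom (nat * int)%type} =>
       \prod_(x <- finsupp m) dvar (x.1, x.2 + n) ^+ m x) p.

Definition u (i : int) : diffpoly F :=
  if i <= 0 then dvar (`|i|%N, 0) else if i == 1 then 1 else 0.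

Definition L : pdo (diffpoly F) := PDO 1 (fun k => u (1 - k%:Z)).

(* a (lambda S)^m b = a S^m(b) lambda^m.                                      *)
Definition lamS (a : diffpoly F) (m : int) (b : diffpoly F) :
    {malg (diffpoly F)[int]} :=
  << a * shift m b *g m >>.

(* With x = lambda S and i <= 0, (x - 1)^-1 (1 - x^(-i)) is the polynomial    *)
(* - sum_(0 <= k < -i) x^k, so that                                           *)
(* (x - x^j) (x - 1)^-1 (1 - x^(-i)) = sum_(0 <= k < -i) (x^(j+k) - x^(1+k)). *)
Definition bracket2D (i j : int) : {malg (diffpoly F)[int]} :=
  \sum_(0 <= n < `|1 - i|.+1)
     (lamS (u (j - n%:Z)) (j - i - n%:Z) (u (i + n%:Z))
      - lamS (u (i + n%:Z)) n%:Z (u (j - n%:Z)))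
  + \sum_(0 <= k < `|i|)
     (lamS (u j) (j + k%:Z) (u i) - lamS (u j) (1 + k%:Z) (u i)).

Definition h (n : nat) : diffpoly F :=
  if n == 0%N then 0 else - (n%:R^-1 : F) *: mRes (pdo_exp shift L n).

End GenericOrderOne.

(* Sanity check of the closed form used for the geometric factor above.       *)
Lemma geometric_factor (R : nzRingType) (k : nat) :
  ('X - 1) * (- \sum_(p < k) 'X^p) = 1 - 'X^k :> {poly R}.
Proof. by rewrite mulrN -subrX1 opprB. Qed.

(* Main.v *)
Require Import Defs.
From HB Require Import structures.
From mathcomp Require Import all_boot all_order all_algebra.
From mathcomp Require Import finmap ring zify.
From Stdlib Require Import ClassicalEpsilon.

(* A multiplicative PVA bracket is the same thing as a Poisson bracket {.,.}
   that commutes with S and is local: {a_lambda b} = sum_n lambda^n {S^n a, b}.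
   Let L_ab = S^a(u_(b-a)) be the Z x Z matrix of L.  On these entries the
   bracket is the quadratic one
     {L_ab, L_cd} = ([b <= d] - [c <= a]) L_ad L_cb
                    + ([b < d] - [a < d] - [c < a] + [c < b]) L_ab L_cd,
   for all a, b, c, d, including the constant entries L_(a,a+1) = 1 and
   L_ab = 0 for b > a + 1.  The Jacobi identity is thus a polynomial identity
   for each relative order of the indices, and it extends from the generators
   because the Jacobiator is a derivation in each argument.

   The flow of int h_n applied to L_cd is
     - sum_(a,b) (L^(n-1))_ba {L_ab, L_cd}.
   The first summand of the bracket contributes [(L^n)_+, L]_cd.  The second
   one contributes a difference of two partial traces of L^n over the same
   diagonal entries, hence 0.  All sums are cut to a box -N <= k <= N of
   indices outside of which their terms vanish.

   The flow acts on L^n by the commutator with Q = (L^m)_+, and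
   mRes [Q, L^n] lies in the image of S - 1, hence the involution.  The
   homomorphism u_0 |-> t, u_i |-> 0 (i < 0) to F[t] kills the image of S - 1
   and sends h_n to - t^n / n, hence the independence. *)

Set Implicit Arguments.
Unset Strict Implicit.
Unset Printing Implicit Defensive.

Import Order.TTheory GRing.Theory Num.Theory.
Local Open Scope ring_scope.

(** * Substitutions in difference polynomials *)

Section Substitution.
Variables (F : fieldType) (A : comNzRingType) (f : {rmorphism F -> A}).
Variable phi : nat * int -> A.

Definition monom_val (m : {cmonom (nat * int)%type}) : A :=
  \prod_(x <- finsupp m) phi x ^+ m x.

Lemma monom_val_is_mmorphism : mmorphism monom_val.
Proof.
(* Exponents vanish outside the support, so the product may run over any finite set containing it;
   this lets two monomials and their product share one index set. *)
have E (d : {fset nat * int}) (m : {cmonom (nat * int)%type}) : (finsupp m `<=` d)%fset ->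
    monom_val m = \prod_(x <- d) phi x ^+ m x.
  move=> sub; rewrite /monom_val; apply/big_fset_incl => // x _.
  by rewrite -cmE_eq0 => /eqP ->.
split; last by rewrite /monom_val mdom1 big_seq_fset0.
move=> m n; rewrite (E _ _ (fsubset_refl _)) mdomD.
rewrite (E _ m (fsubsetUl _ (finsupp n))) (E _ n (fsubsetUr (finsupp m) _)).
by rewrite -big_split; apply: eq_bigr => x _; rewrite cmM exprD.
Qed.

HB.instance Definition _ :=
  monalg.isMultiplicative.Build _ _ monom_val monom_val_is_mmorphism.

Definition subst (p : diffpoly F) : A := mmap f monom_val p.

HB.instance Definition _ := GRing.RMorphism.copy subst (mmap f monom_val).

Lemma substC c : subst c%:A = f c.
Proof. by rewrite /subst mmapZ mmap1 mulr1. Qed.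

Lemma subst_dvar x : subst (dvar F x) = phi x.
Proof.
by rewrite /subst /dvar mmapU /= rmorph1 mul1r /monom_val mdomU big_seq_fset1 cmUU.
Qed.

End Substitution.

Section Induction.
Variable F : fieldType.
Local Notation V := (diffpoly F).

(** Monomials are reached by induction on the degree, splitting off one variable at a time. *)
Lemma diffpoly_ind (P : V -> Prop) :
    (forall c : F, P c%:A) -> (forall x, P (dvar F x)) ->
    (forall p q, P p -> P q -> P (p + q)) ->
    (forall p q, P p -> P q -> P (p * q)) ->
  forall p, P p.
Proof.
move=> PC Px PD PM p.
have P1 : P 1 by have := PC 1; rewrite scale1r.
have P0 : P 0 by have := PC 0; rewrite scale0r.
have Pm n : forall m, (mdeg m <= n)%N -> P << m >>.
  elim: n => [|n IH] m; first by rewrite leqn0 => /eqP/mdeg_eq0I ->.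
  have [m1|/fset0Pn [x mx]] := eqVneq (finsupp m) fset0.
    by move=> _; apply: IH; rewrite mdegE m1 big_seq_fset0.
  have -> : m = mmul (ucm x) (divcm m (ucm x)).
    apply/eqP/cmP => y; rewrite cmM divcmE cmU.
    by case: eqVneq => [<-|_]; rewrite ?subn0 // subnKC // lt0n cmE_neq0.
  rewrite mdegM mdegU add1n ltnS => le_n.
  have -> : << mmul (ucm x) (divcm m (ucm x)) >>
      = dvar F x * << divcm m (ucm x) >> :> V.
    by rewrite malgM_def fgmulUU mulr1.
  exact: (PM _ _ (Px x) (IH _ le_n)).
rewrite [p]monalgE; apply: (big_ind P P0 PD) => m _.
have -> : << p@_m *g m >> = p@_m *: << m >> :> V.
  by rewrite -mul_malgC malgM_def fgmulUU mulr1 mul1m.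
by rewrite -mulr_algl; exact: (PM _ _ (PC _) (Pm _ _ (leqnn _))).
Qed.
End Induction.

(** * Derivations *)

Section Derivations.
Variables (F : fieldType) (V : comAlgType F).

Record is_der (D : V -> V) : Prop := IsDer {
  der_linear : forall (k : F) a b, D (k *: a + b) = k *: D a + D b;
  der_mul : forall a b, D (a * b) = D a * b + a * D b
}.

Lemma der0 D : is_der D -> D 0 = 0.
Proof.
move=> [lin _]; have := lin (- 1) 0 0.
by rewrite scaler0 addr0 scaleN1r addNr.
Qed.

Lemma derD D : is_der D -> {morph D : a b / a + b}.
Proof. by move=> [lin _] a b; have := lin 1 a b; rewrite !scale1r. Qed.

Lemma derZ D (k : F) a : is_der D -> D (k *: a) = k *: D a.
Proof. by move=> DD; rewrite -[k *: a]addr0 der_linear // der0 // addr0. Qed.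

Lemma derN D : is_der D -> {morph D : a / - a}.
Proof. by move=> DD a; rewrite -scaleN1r derZ // scaleN1r. Qed.

Lemma derB D : is_der D -> {morph D : a b / a - b}.
Proof. by move=> DD a b; rewrite derD // derN. Qed.

Lemma der1 D : is_der D -> D 1 = 0.
Proof.
move=> DD; have := der_mul DD 1 1; rewrite !mulr1 mul1r => e.
by apply: (addrI (D 1)); rewrite -e addr0.
Qed.

Lemma derC D (c : F) : is_der D -> D c%:A = 0.
Proof. by move=> DD; rewrite derZ // der1 // scaler0. Qed.

Lemma der_sum D (I : Type) (r : seq I) (P : pred I) (G : I -> V) : is_der D ->
  D (\sum_(i <- r | P i) G i) = \sum_(i <- r | P i) D (G i).
Proof. by move=> DD; apply: big_morph; [exact: derD | exact: der0]. Qed.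

End Derivations.

Lemma coefM1 (R : nzRingType) (p q : {poly R}) :
  (p * q)`_1 = p`_1 * q`_0 + p`_0 * q`_1.
Proof. by rewrite coefM !big_ord_recl big_ord0 addr0 addrC. Qed.

(** * Shifts, and derivations with prescribed values on the variables *)

Section Shift.
Variable F : fieldType.
Local Notation V := (diffpoly F).

Lemma shiftE n (p : V) :
  shift n p = subst (GRing.in_alg V) (fun x => dvar F (x.1, x.2 + n)) p.
Proof. by []. Qed.

Lemma shift_dvar n x : shift n (dvar F x) = dvar F (x.1, x.2 + n).
Proof. by rewrite shiftE subst_dvar. Qed.

Lemma shiftC n (c : F) : shift n (c%:A : V) = c%:A.
Proof. by rewrite shiftE substC. Qed.

Lemma shiftD n (p q : V) : shift n (p + q) = shift n p + shift n q.
Proof. by rewrite !shiftE rmorphD. Qed.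

Lemma shiftM n (p q : V) : shift n (p * q) = shift n p * shift n q.
Proof. by rewrite !shiftE rmorphM. Qed.

Lemma is_aut_powers_shift : is_aut_powers (@shift F).
Proof.
split=> [n c a b|n|n a b|a|m n a].
- by rewrite shiftD -mulr_algl shiftM shiftC mulr_algl.
- by rewrite shiftE rmorph1.
- exact: shiftM.
- elim/diffpoly_ind: a => [c|[x y]|p q Hp Hq|p q Hp Hq].
  + exact: shiftC.
  + by rewrite shift_dvar addr0.
  + by rewrite shiftD Hp Hq.
  + by rewrite shiftM Hp Hq.
- elim/diffpoly_ind: a => [c|[x y]|p q Hp Hq|p q Hp Hq].
  + by rewrite !shiftC.
  + by rewrite !shift_dvar /= addrAC addrA.
  + by rewrite !shiftD Hp Hq.
  + by rewrite !shiftM Hp Hq.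
Qed.

Lemma der_eq (D E : V -> V) : is_der D -> is_der E ->
  (forall x, D (dvar F x) = E (dvar F x)) -> D =1 E.
Proof.
move=> dD dE e p.
elim/diffpoly_ind: p => [c|x|p q Hp Hq|p q Hp Hq].
- by rewrite (derC c dD) (derC c dE).
- exact: e.
- by rewrite (derD dD) (derD dE) Hp Hq.
- by rewrite (der_mul dD) (der_mul dE) Hp Hq.
Qed.

(* The first-order part of the substitution x |-> x + phi(x) epsilon. *)
Definition der_ext (phi : nat * int -> V) (p : V) : V :=
  (subst (polyC \o GRing.in_alg V)
     (fun x => (dvar F x)%:P + phi x *: 'X) p)`_1.

Lemma der_ext_dvar phi x : der_ext phi (dvar F x) = phi x.
Proof. by rewrite /der_ext subst_dvar coefD coefC coefZ coefX /= add0r mulr1. Qed.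

(** The substitution is a ring morphism whose constant term is the identity, so its coefficient of
    degree 1 obeys the Leibniz rule. *)
Lemma is_der_ext phi : is_der (der_ext phi).
Proof.
rewrite /der_ext; set s := subst _ _.
have sD p q : s (p + q) = s p + s q by rewrite /s rmorphD.
have sM p q : s (p * q) = s p * s q by rewrite /s rmorphM.
have sC c : s c%:A = c%:A%:P by rewrite /s substC.
have sX x : s (dvar F x) = (dvar F x)%:P + phi x *: 'X by rewrite /s subst_dvar.
move: s sD sM sC sX => s sD sM sC sX.
have s0 p : (s p)`_0 = p.
  elim/diffpoly_ind: p => [c|x|p q Hp Hq|p q Hp Hq].
  - by rewrite sC coefC.
  - by rewrite sX coefD coefC coefZ coefX /= mulr0 addr0.
  - by rewrite sD coefD Hp Hq.
  - by rewrite sM coefM big_ord_recl big_ord0 addr0 subn0 Hp Hq.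
have s1M p q : (s (p * q))`_1 = (s p)`_1 * q + p * (s q)`_1.
  by rewrite sM coefM1 (s0 p) (s0 q).
split=> // k a b; rewrite sD coefD -mulr_algl s1M.
by rewrite sC coefC /= mul0r add0r mulr_algl.
Qed.

End Shift.

(** * The quadratic bracket on matrices *)

Section QuadraticBracket.
Variables (A : comNzRingType) (M : int -> int -> A).

Definition swap_coef (a b c d : int) : A := (b <= d)%R%:R - (c <= a)%R%:R.

Definition diag_coef (a b c d : int) : A :=
  (b < d)%R%:R - (a < d)%R%:R - (c < a)%R%:R + (c < b)%R%:R.

Definition quad_br (a b c d : int) : A :=
  swap_coef a b c d * (M a d * M c b) + diag_coef a b c d * (M a b * M c d).

(** The two coefficients are not separately antisymmetric. Their defects are opposite and occur only
    for a = c or b = d, where the products M_ad M_cb and M_ab M_cd coincide. *)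
Lemma quad_br_skew a b c d : quad_br c d a b = - quad_br a b c d.
Proof.
rewrite /quad_br /swap_coef /diag_coef.
by case: (ltgtP b d) => [?|?|->]; case: (ltgtP a c) => [?|?|->] /=; ring.
Qed.

(* The monomials M_ab M_cf M_ed, ... coincide when two row or two column indices
   are equal, and the identity is polynomial only for a fixed relative order. *)
Lemma quad_br_jacobi a b c d e f :
  let K a b c d e f :=
    swap_coef c d e f * (quad_br a b c f * M e d + M c f * quad_br a b e d)
    + diag_coef c d e f * (quad_br a b c d * M e f + M c d * quad_br a b e f) in
  K a b c d e f - K c d a b e f + K e f a b c d = 0.
Proof.
move=> K; rewrite {}/K /quad_br /swap_coef /diag_coef.
(* The identity holds whatever the values of the comparisons between a row and a column index, so
   these become free ring elements. Only the orders of the three columns and of the three rows are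
   split into cases. *)
move: ((a < d)%R%:R : A) ((c < b)%R%:R : A) ((a < f)%R%:R : A).
move: ((e < b)%R%:R : A) ((c < f)%R%:R : A) ((e < d)%R%:R : A).
move=> s1 s2 s3 s4 s5 s6.
case: (ltgtP b d) => [?|?|?]; case: (ltgtP b f) => [?|?|?];
  case: (ltgtP d f) => [?|?|?]; try (exfalso; lia).
all: case: (ltgtP a c) => [?|?|?]; case: (ltgtP a e) => [?|?|?];
  case: (ltgtP c e) => [?|?|?]; try (exfalso; lia).
all: subst=> /=; ring.
Qed.

Hypothesis M1 : forall a, M a (a + 1) = 1.
Hypothesis M0 : forall a b, a + 1 < b -> M a b = 0.

(** Constant entries must be central. For b = a + 1 the second coefficient is [c = a] - [d = a + 1],
    and the first summand cancels it because M vanishes above its superdiagonal. *)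
Lemma quad_br_unit a c d : quad_br a (a + 1) c d = 0.
Proof.
rewrite /quad_br /swap_coef /diag_coef M1.
have -> : (c < a + 1)%R = (c <= a) by lia.
have -> : (a < d)%R = (a + 1 <= d) by lia.
case: (ltgtP (a + 1) d) => [ad|?|<-]; case: (ltgtP c a) => [?|?|->] /=;
  rewrite ?M1; try rewrite (M0 ad);
  try (rewrite (_ : M c (a + 1) = 0); last by apply: M0; lia); ring.
Qed.

(** If b <= d then M_ad = 0, and if c <= a then M_cb = 0; the second summand contains M_ab. *)
Lemma quad_br_zero a b c d : a + 1 < b -> quad_br a b c d = 0.
Proof.
move=> ab; rewrite /quad_br /swap_coef (M0 ab) mul0r mulr0 addr0.
case: (lerP b d) => bd; first by rewrite (@M0 a d) ?mul0r ?mulr0 //; lia.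
case: (lerP c a) => ca; first by rewrite (@M0 c b) ?mulr0 //; lia.
by rewrite subrr mul0r.
Qed.

(** This is the source of locality. Skew-symmetry exchanges the two alternatives; if a + 1 < d, the
    first summand contains M_ad = 0 and, unless M_ab or M_cd is zero, the four indicators of the
    second cancel. *)
Lemma quad_br_far a b c d : (a + 1 < d) || (c + 1 < b) -> quad_br a b c d = 0.
Proof.
wlog ad : a b c d / a + 1 < d => [H|_].
  by case/orP => l; [|rewrite -[LHS]opprK -quad_br_skew]; rewrite H ?oppr0 ?l.
have [/quad_br_zero -> //|ba] := ltrP (a + 1) b.
have [/quad_br_zero e|dc] := ltrP (c + 1) d.
  by rewrite -[LHS]opprK -quad_br_skew e oppr0.
rewrite /quad_br /diag_coef (@M0 a d ad) mul0r mulr0 add0r.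
have -> : (b < d)%R by lia.
have -> : (a < d)%R by lia.
have -> : (c < a)%R = false by lia.
have -> : (c < b)%R = false by lia.
by rewrite /= !subrr addr0 mul0r.
Qed.

End QuadraticBracket.

(** * Poisson brackets commuting with the shifts *)

Section Poisson.
Variables (F : fieldType) (V : comAlgType F) (S : int -> V -> V).
Hypothesis autS : is_aut_powers S.

(** The Jacobi identity is kept apart: it is verified on generators and extended afterwards, with
    the help of these properties. *)
Record is_poisson (B : V -> V -> V) : Prop := IsPoisson {
  poisson_der : forall a, is_der (B a);
  poisson_skew : forall a b, B b a = - B a b;
  poisson_equiv : forall n a b, S n (B a b) = B (S n a) (S n b)
}.

Variable B : V -> V -> V.
Hypothesis PB : is_poisson B.

Lemma poisson_derl b : is_der (B^~ b).
Proof.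
have sk a : B a b = - B b a by exact: (poisson_skew PB).
split=> [k x y|x y]; rewrite !sk.
  by rewrite (der_linear (poisson_der PB b)) opprD scalerN.
by rewrite (der_mul (poisson_der PB b)) opprD mulNr mulrN.
Qed.

Lemma der_bool (D : V -> V) (b : bool) : is_der D -> D b%:R = 0.
Proof. by move=> DD; case: b; rewrite ?der1 ?der0. Qed.

Variable M : int -> int -> V.
Hypothesis BM : forall a b c d, B (M a b) (M c d) = quad_br M a b c d.

(** The coefficients of the quadratic bracket are integers, hence killed by derivations. Each nested
    bracket thus becomes the cubic expression of [quad_br_jacobi]. *)
Lemma poisson_quad_jacobi a b c d e f :
  B (M a b) (B (M c d) (M e f)) - B (M c d) (B (M a b) (M e f))
  = B (B (M a b) (M c d)) (M e f).
Proof.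
have K x y z t r s : B (M x y) (quad_br M z t r s)
    = swap_coef V z t r s
        * (quad_br M x y z s * M r t + M z s * quad_br M x y r t)
    + diag_coef V z t r s
        * (quad_br M x y z t * M r s + M z t * quad_br M x y r s).
  have DB := poisson_der PB (M x y).
  have Dd p q : B (M x y) (swap_coef V z t r s * p + diag_coef V z t r s * q)
      = swap_coef V z t r s * B (M x y) p + diag_coef V z t r s * B (M x y) q.
    rewrite (derD DB) !(der_mul DB).
    have -> : B (M x y) (swap_coef V z t r s) = 0.
      by rewrite (derB DB) !(der_bool _ DB) subrr.
    have -> : B (M x y) (diag_coef V z t r s) = 0.
      by rewrite (derD DB) !(derB DB) !(der_bool _ DB) !subrr add0r.
    by rewrite !mul0r !add0r.
  by rewrite Dd !(der_mul DB) !BM.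
rewrite [B (B _ _) _](poisson_skew PB) !BM.
apply/eqP; rewrite -subr_eq0 opprK !K; apply/eqP; exact: quad_br_jacobi.
Qed.

End Poisson.

(** * The matrix of L *)

Lemma mulrb_eq (A : nmodType) (b c : bool) (x y : A) :
  (b != c -> x = 0) -> (c -> x = y) -> x *+ b = y *+ c.
Proof.
case: b; case: c => h e; rewrite ?mulr0n ?mulr1n //; [exact: e|exact: h|].
by rewrite -e // h.
Qed.

(** Puts a quadratic bracket into the shape of four terms with one Boolean multiplicity each, one
    for each of the four sums defining [bracket2D]. *)
Lemma bool_comb (A : comNzRingType) (b1 b2 c1 c2 c3 c4 : bool) (x y z t : A) :
  (c2 -> c1) -> (c4 -> c3) ->
  (b1%:R - b2%:R) * (x * y) + (c1%:R - c2%:R - c3%:R + c4%:R) * (z * t)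
  = (y * x) *+ b1 - (y * x) *+ b2
    + ((t * z) *+ (~~ c2 && c1) - (t * z) *+ (c3 && ~~ c4)).
Proof.
case: c1 c2 c3 c4 => -[] -[] -[] //; try (by move=> /(_ isT)); try (by move=> _ /(_ isT));
  move=> _ _; case: b1; case: b2 => /=; ring.
Qed.

Section GenericMatrix.
Variable F : fieldType.
Local Notation V := (diffpoly F).

Definition Lmat (a b : int) : V := shift a (u F (b - a)).

Lemma Lmat1 a : Lmat a (a + 1) = 1.
Proof. by rewrite /Lmat addrAC subrr add0r /u /= (aut_one (is_aut_powers_shift F)). Qed.

Lemma u_gt1 i : 1 < i -> u F i = 0.
Proof. by move=> i1; rewrite /u; case: ifP; [lia|case: ifP => //; lia]. Qed.

Lemma shift0 n : shift n (0 : V) = 0.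
Proof. by rewrite -(scale0r 1) shiftC scale0r. Qed.

Lemma Lmat0 a b : a + 1 < b -> Lmat a b = 0.
Proof. by move=> ab; rewrite /Lmat u_gt1 ?shift0 //; lia. Qed.

Lemma shift_Lmat n a b : shift n (Lmat a b) = Lmat (a + n) (b + n).
Proof.
rewrite /Lmat -(aut_powD (is_aut_powers_shift F)) [n + a]addrC.
by congr (shift _ (u F _)); lia.
Qed.

Lemma Lmat_dvar a b : b <= a -> Lmat a b = dvar F (`|a - b|%N, a).
Proof.
move=> ba; rewrite /Lmat /u; case: ifP => [_|]; last by lia.
by rewrite shift_dvar /= add0r distnC.
Qed.

Lemma sum_indicator (A : nmodType) (G : int -> A) (K : nat) (t : int) :
  \sum_(0 <= n < K) G n%:Z *+ (n%:Z == t) = G t *+ (0 <= t < K%:Z)%R.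
Proof.
elim: K => [|K IH].
  by rewrite big_nil; case: andP => // -[]; lia.
rewrite big_nat_recr //= IH; have [<-|Kt] := eqVneq K%:Z t.
  rewrite (_ : (_ < K%:Z) = false) ?andbF ?add0r; last by lia.
  by rewrite (_ : _ && _ = true) //; lia.
by rewrite addr0; congr (_ *+ _); congr nat_of_bool; lia.
Qed.

Lemma lamS_coef (p q : V) n m : (lamS p n q)@_m = (p * shift n q) *+ (n == m).
Proof. exact: mcoeffU. Qed.

Lemma mcoeff_lam_sum (I J : Type) (r : seq I) (s : seq J)
    (x y : I -> {malg V[int]}) (z t : J -> {malg V[int]}) (m : int) :
  (\sum_(n <- r) (x n - y n) + \sum_(n <- s) (z n - t n))@_m
  = \sum_(n <- r) (x n)@_m - \sum_(n <- r) (y n)@_m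
    + (\sum_(n <- s) (z n)@_m - \sum_(n <- s) (t n)@_m).
Proof. by rewrite !sumrB mcoeffD !mcoeffB !raddf_sum. Qed.

Lemma lamS_sum (K : nat) (p q : int -> V) (e : int -> int) (m t : int) :
  (forall n, (e n == m) = (n == t)) ->
  \sum_(0 <= n < K) (lamS (p n%:Z) (e n%:Z) (q n%:Z))@_m
  = (p t * shift m (q t)) *+ (0 <= t < K%:Z)%R.
Proof.
move=> et; rewrite -(sum_indicator (fun n => p n * shift m (q n))).
apply: eq_bigr => n _; rewrite lamS_coef -et.
by apply: mulrb_eq => [|/eqP <-]; rewrite ?eqxx.
Qed.

(** The coefficient of lambda^m should be {S^m u_i, u_j}, and S^m u_i and u_j are the entries
    L_(m,m+i) and L_(0,j). Each of the four sums meets lambda^m in at most one term. *)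
Lemma bracket2D_coef i j m : i <= 0 -> j <= 0 ->
  (bracket2D F i j)@_m = quad_br Lmat m (m + i) 0 j.
Proof.
move=> i0 j0; rewrite /bracket2D mcoeff_lam_sum.
have -> : quad_br Lmat m (m + i) 0 j =
   (Lmat 0 (m + i) * Lmat m j) *+ (m + i <= j)%R
   - (Lmat 0 (m + i) * Lmat m j) *+ (0 <= m)%R
   + ((Lmat 0 j * Lmat m (m + i)) *+ (0 <= m - j < `|i|%N)%R
     - (Lmat 0 j * Lmat m (m + i)) *+ (0 <= m - 1 < `|i|%N)%R).
  rewrite /quad_br /swap_coef /diag_coef.
  have -> : (0 <= m - j < `|i|%N)%R = ~~ (m < j) && (m + i < j) by lia.
  have -> : (0 <= m - 1 < `|i|%N)%R = (0 < m) && ~~ (0 < m + i) by lia.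
  by apply: bool_comb; lia.
have L0 k : Lmat 0 k = u F k.
  by rewrite /Lmat subr0 (aut_pow0 (is_aut_powers_shift F)).
have Lm k l : l = k - m -> shift m (u F l) = Lmat m k.
  by move=> ->.
have D4 (x y z t x' y' z' t' : V) : x = x' -> y = y' -> z = z' -> t = t' ->
  x - y + (z - t) = x' - y' + (z' - t') by move=> -> -> -> ->.
apply: D4.
(* The term is n = j - i - m here and n = m in the second sum. The bound n <= 1 - i loses nothing,
   since u_(i+n) = 0 beyond it. *)
- apply: etrans (@lamS_sum _ (fun n => u F (j - n)) (fun n => u F (i + n))
    (fun n => j - i - n) m (j - i - m) _) _ => [n|]; first by lia.
  apply: mulrb_eq => [h|h].
    by rewrite [u F (i + _)]u_gt1 ?shift0 ?mulr0 //; lia.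
  by rewrite L0 (Lm j); [congr (u F _ * _)|]; lia.
- apply: etrans (@lamS_sum _ (fun n => u F (i + n)) (fun n => u F (j - n))
    (fun n => n) m m _) _ => //.
  apply: mulrb_eq => [h|h].
    by rewrite u_gt1 ?mul0r //; lia.
  by rewrite L0 [m + i]addrC (Lm j _ erefl).
(* In the two sums of the geometric factor the terms are n = m - j and n = m - 1. *)
- apply: etrans (@lamS_sum _ (fun=> u F j) (fun=> u F i)
    (fun n => j + n) m (m - j) _) _ => [n|]; first by lia.
  by rewrite L0 (Lm (m + i)); [|lia].
- apply: etrans (@lamS_sum _ (fun=> u F j) (fun=> u F i)
    (fun n => 1 + n) m (m - 1) _) _ => [n|]; first by lia.
  by rewrite L0 (Lm (m + i)); [|lia].
Qed.
End GenericMatrix.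

(** * Extending a bracket from the generators *)

Section PoissonExtension.
Variables (F : fieldType) (V : comAlgType F) (S : int -> V -> V).
Hypothesis autS : is_aut_powers S.
Variables (I : Type) (X : I -> V) (ext : (I -> V) -> V -> V).
Hypothesis der_eqX : forall D E : V -> V, is_der D -> is_der E ->
  (forall i, D (X i) = E (X i)) -> D =1 E.
Hypothesis is_der_extX : forall phi, is_der (ext phi).
Hypothesis extX : forall phi i, ext phi (X i) = phi i.

Lemma is_derM c (D : V -> V) : is_der D -> is_der (fun a => c * D a).
Proof.
move=> dD; split=> [l a b|a b].
  by rewrite (der_linear dD) mulrDr scalerAr.
by rewrite (der_mul dD) mulrDr !mulrA [a * c]mulrC.
Qed.

Lemma is_derD (D E : V -> V) : is_der D -> is_der E -> is_der (fun a => D a + E a).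
Proof.
move=> dD dE; split=> [l a b|a b].
  by rewrite (der_linear dD) (der_linear dE) scalerDr addrACA.
by rewrite (der_mul dD) (der_mul dE) mulrDl mulrDr addrACA.
Qed.

Lemma is_derN (D : V -> V) : is_der D -> is_der (fun a => - D a).
Proof.
move=> dD; split=> [l a b|a b].
  by rewrite (der_linear dD) opprD scalerN.
by rewrite (der_mul dD) opprD mulNr mulrN.
Qed.

Lemma is_der_comm (D E : V -> V) : is_der D -> is_der E ->
  is_der (fun a => D (E a) - E (D a)).
Proof.
move=> dD dE; split=> [l a b|a b].
  rewrite (der_linear dD) (der_linear dE) (der_linear dD) (der_linear dE).
  by rewrite scalerBr opprD addrACA.
rewrite (der_mul dD) (der_mul dE) (derD dD) (derD dE) !(der_mul dD) !(der_mul dE).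
ring.
Qed.

Lemma is_der_shift (n : int) (D : V -> V) : is_der D ->
  is_der (fun a => S (- n) (D (S n a))).
Proof.
move=> dD; have SK a : S (- n) (S n a) = a.
  by rewrite -(aut_powD autS) addNr (aut_pow0 autS).
have SD m a b : S m (a + b) = S m a + S m b.
  by have := aut_linear autS m 1 a b; rewrite !scale1r.
split=> [l a b|a b].
  by rewrite (aut_linear autS) (der_linear dD) (aut_linear autS).
by rewrite (aut_mul autS) (der_mul dD) SD !(aut_mul autS) !SK.
Qed.

Variable pi : I -> I -> V.
Hypothesis pi_skew : forall i j, pi j i = - pi i j.

(** The derivation {f, .} is determined by its values {f, X_j} = - {X_j, f}, which come from the
    derivations {X_j, .} with values [pi j]. *)
Definition ext_br (f g : V) : V := ext (fun j => - ext (pi j) f) g.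

Lemma ext_brX i g : ext_br (X i) g = ext (pi i) g.
Proof.
rewrite /ext_br; apply: der_eqX => [||j]; try exact: is_der_extX.
by rewrite !extX pi_skew opprK.
Qed.

Lemma ext_br_der f : is_der (ext_br f).
Proof. exact: is_der_extX. Qed.

(** [ext] is linear over V in the prescribed values, and here these values are derivations of f. *)
Lemma ext_br_derl g : is_der (ext_br^~ g).
Proof.
have H phi psi chi : (forall i, chi i = phi i + psi i) ->
    forall a, ext chi a = ext phi a + ext psi a.
  move=> e; apply: der_eqX => [||i]; try exact: is_der_extX.
  - by apply: is_derD; exact: is_der_extX.
  - by rewrite !extX e.
have HZ c phi psi : (forall i, psi i = c * phi i) ->
    forall a, ext psi a = c * ext phi a.
  move=> e; apply: der_eqX => [||i]; try exact: is_der_extX.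
  - by apply: is_derM; exact: is_der_extX.
  - by rewrite !extX e.
split=> [k a b|a b]; rewrite /ext_br.
  rewrite (H (fun j => k%:A * - ext (pi j) a) (fun j => - ext (pi j) b)).
    by rewrite (HZ k%:A (fun j => - ext (pi j) a)) // mulr_algl.
  move=> j; rewrite (der_linear (is_der_extX _)) opprD mulr_algl.
  by rewrite scalerN.
rewrite (H (fun j => b * - ext (pi j) a) (fun j => a * - ext (pi j) b)).
  rewrite (HZ b (fun j => - ext (pi j) a) (fun j => b * - ext (pi j) a)) //.
  rewrite (HZ a (fun j => - ext (pi j) b) (fun j => a * - ext (pi j) b)) //.
  by rewrite [b * _]mulrC.
by move=> j; rewrite (der_mul (is_der_extX _)) opprD !mulrN mulrC.
Qed.

Lemma bider_eq (B C : V -> V -> V) :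
  (forall a, is_der (B a)) -> (forall a, is_der (C a)) ->
  (forall b, is_der (B^~ b)) -> (forall b, is_der (C^~ b)) ->
  (forall i j, B (X i) (X j) = C (X i) (X j)) -> forall a b, B a b = C a b.
Proof.
move=> B1 C1 B2 C2 e a; apply: der_eqX => // j.
by move: a; apply: (der_eqX (B2 _) (C2 _)) => i; exact: e.
Qed.

Variable sh : int -> I -> I.
Hypothesis S_X : forall n i, S n (X i) = X (sh n i).
Hypothesis pi_equiv : forall n i j, S n (pi i j) = pi (sh n i) (sh n j).

(** In each identity both sides are derivations in either argument and agree on the generators;
    conjugation by S^n preserves derivations. *)
Lemma is_poisson_ext : is_poisson S ext_br.
Proof.
have dl := ext_br_derl; have dr := ext_br_der.
have SK n a : S (- n) (S n a) = a.
  by rewrite -(aut_powD autS) addNr (aut_pow0 autS).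
split=> // [a b|n a b].
  apply: (@bider_eq (fun a b => ext_br b a) (fun a b => - ext_br a b)) => //.
  - by move=> c; apply/is_derN/dr.
  - by move=> c; apply: is_derN (dl c).
  - by move=> i j; rewrite !ext_brX !extX.
have -> : ext_br a b = S (- n) (ext_br (S n a) (S n b)).
  apply: (@bider_eq _ (fun a b => S (- n) (ext_br (S n a) (S n b)))) => //.
  - by move=> c; apply: is_der_shift.
  - by move=> c; apply: (is_der_shift n (dl (S n c))).
  - move=> i j; rewrite !S_X !ext_brX !extX -pi_equiv SK //.
by rewrite -{1}[n]opprK SK.
Qed.

Definition jacobi_at (B : V -> V -> V) a b c : Prop :=
  B a (B b c) - B b (B a c) = B (B a b) c.

(** In the last argument the identity compares two derivations, so it extends from generators there.
    Permuting the arguments brings each of them to the last place in turn. *)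
Lemma ext_br_jacobi :
  (forall i j k, jacobi_at ext_br (X i) (X j) (X k)) ->
  forall a b c, jacobi_at ext_br a b c.
Proof.
have [dr skew _] := is_poisson_ext.
have red a b : (forall k, jacobi_at ext_br a b (X k)) -> forall c, jacobi_at ext_br a b c.
  move=> e c; rewrite /jacobi_at.
  by apply: (der_eqX (is_der_comm (dr a) (dr b)) (dr (ext_br a b)) e).
have swap23 a b c : jacobi_at ext_br a b c -> jacobi_at ext_br a c b.
  rewrite /jacobi_at => e; rewrite (skew b c) (derN (dr a)).
  by rewrite (skew (ext_br a b) c) (skew b (ext_br a c)) -e; ring.
have swap12 a b c : jacobi_at ext_br a b c -> jacobi_at ext_br b a c.
  rewrite /jacobi_at => e; rewrite (skew a b) (skew c (- _)) (derN (dr c)).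
  by rewrite (skew (ext_br a b) c) -e; ring.
move=> J.
have J1 i j c : jacobi_at ext_br (X i) (X j) c by apply: red => k; exact: J.
have J2 i b c : jacobi_at ext_br (X i) b c by apply: red => k; apply/swap23/J1.
by move=> a b c; apply: red => k; apply/swap23/swap12/swap23/J2.
Qed.

End PoissonExtension.

(** * Poisson brackets and multiplicative PVAs *)

Section Box.

Definition box (N : nat) : seq int := [seq k%:Z - N%:Z | k <- iota 0 N.*2.+1].

Lemma mem_box N (n : int) : (n \in box N) = (`|n| <= N)%N.
Proof.
apply/mapP/idP => [[k]|nN]; first by rewrite mem_iota => /andP [_ kN] ->; lia.
by exists `|(n + N%:Z)%R|%N; rewrite ?mem_iota; lia.
Qed.

Lemma box_uniq N : uniq (box N).
Proof. by rewrite map_inj_uniq ?iota_uniq // => k l; lia. Qed.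

Lemma box_sum1 (A : nmodType) N (G : int -> A) n : (`|n| <= N)%N ->
  (forall k, k \in box N -> k != n -> G k = 0) -> \sum_(k <- box N) G k = G n.
Proof.
rewrite -mem_box => nN G0; rewrite (bigD1_seq n) ?box_uniq //=.
by rewrite big_seq_cond big1 ?addr0 // => k /andP [kN kn]; apply: G0.
Qed.

Lemma uniq_sum_supp (A : nmodType) (r s : seq int) (G : int -> A) :
  uniq r -> uniq s -> {subset r <= s} ->
  (forall k, k \in s -> k \notin r -> G k = 0) ->
  \sum_(k <- r) G k = \sum_(k <- s) G k.
Proof.
move=> ur us rs G0; rewrite [RHS](bigID (mem r)) /= [X in _ + X]big_seq_cond.
rewrite [X in _ + X]big1 ?addr0 => [|k /andP [ks kr]]; last exact: G0.
rewrite -[RHS]big_filter; apply: perm_big; apply: uniq_perm; rewrite ?filter_uniq //.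
by move=> k; rewrite mem_filter /= andb_idr // => /rs.
Qed.

Lemma box_sum_supp (A : nmodType) N N' (G : int -> A) : (N <= N')%N ->
  (forall k : int, (N < `|k|)%N -> G k = 0) ->
  \sum_(k <- box N) G k = \sum_(k <- box N') G k.
Proof.
move=> NN' G0; apply: uniq_sum_supp; rewrite ?box_uniq //.
  by move=> k; rewrite !mem_box => kN; apply: leq_trans NN'.
by move=> k _; rewrite mem_box -ltnNge; apply: G0.
Qed.

Lemma box_sum_opp (A : nmodType) N (G : int -> A) :
  \sum_(k <- box N) G k = \sum_(k <- box N) G (- k).
Proof.
rewrite -[RHS](big_map -%R xpredT); apply: perm_big.
apply: uniq_perm; first exact: box_uniq.
  by rewrite (map_inj_uniq (@oppr_inj _)) box_uniq.
move=> k; rewrite mem_box; apply/idP/mapP => [kN|[l]].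
  by exists (- k); rewrite ?opprK // mem_box; lia.
by rewrite mem_box => lN ->; lia.
Qed.

End Box.

(** * Passage between local Poisson brackets and mPVA brackets *)

Section LocalPoisson.
Variables (F : fieldType) (V : comAlgType F) (S : int -> V -> V).
Hypothesis autS : is_aut_powers S.

Definition local_at (B : V -> V -> V) (f g : V) : Prop :=
  exists N : nat, forall n : int, (N < `|n|)%N -> B (S n f) g = 0.

Lemma mPVA_of_poisson B : is_poisson S B ->
  (forall a b c, jacobi_at B a b c) -> (forall f g, local_at B f g) ->
  exists br : V -> V -> {malg V[int]}, is_mPVA S br /\
    forall f g n, (br f g)@_n = B (S n f) g.
Proof.
move=> PB J loc.
(* Locality only asserts that a bound exists for each pair, so one is chosen by the epsilon
   operator; the coefficients do not depend on the choice. *)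
pose N f g := proj1_sig (constructive_indefinite_description _ (loc f g)).
have NP f g n : (N f g < `|n|)%N -> B (S n f) g = 0.
  exact: (proj2_sig (constructive_indefinite_description _ (loc f g))).
pose br f g : {malg V[int]} := \sum_(n <- box (N f g)) << B (S n f) g *g n >>.
have brE f g n : (br f g)@_n = B (S n f) g.
  rewrite raddf_sum /=; have [nN|/NP e] := leqP `|n| (N f g).
    rewrite (box_sum1 (n := n)) ?mcoeffUU // => k _ kn.
    by rewrite mcoeffU (negbTE kn).
  rewrite big_seq big1 ?e // => k; rewrite mem_box mcoeffU.
  by case: eqVneq => // -> ; rewrite e.
have dr := poisson_der PB; have dl := poisson_derl PB.
have SS m n a : S m (S n a) = S (m + n) a by rewrite (aut_powD autS).
have eqv := poisson_equiv PB; have skew := poisson_skew PB.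
exists br; split=> //; split=> //.
- move=> k a b c n; rewrite !brE (aut_linear autS).
  by rewrite (der_linear (dl c)).
- by move=> k a b c n; rewrite !brE (der_linear (dr _)).
- by move=> a b n; rewrite !brE SS.
- by move=> a b n; rewrite !brE eqv SS addrCA subrr addr0.
- by move=> a b c n; rewrite !brE (der_mul (dr _)) [b * _]mulrC.
- move=> a b c n; rewrite !brE (aut_mul autS) (der_mul (dl c)).
  by rewrite [S n a * _]mulrC.
- move=> a b n; rewrite !brE eqv SS subrr (aut_pow0 autS); exact: skew.
- by move=> a b c m n; rewrite !brE J eqv SS addrCA subrr addr0.
Qed.

Section OfMPVA.
Variable br : V -> V -> {malg V[int]}.
Hypothesis mbr : is_mPVA S br.

Definition br0 (f g : V) : V := (br f g)@_0.

(** Sesquilinearity gives this for n >= 0; for n < 0 the same rule is applied to S^n f. *)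
Lemma mPVA_coef f g n : (br f g)@_n = br0 (S n f) g.
Proof.
have SS m k a : S m (S k a) = S (m + k) a by rewrite (aut_powD autS).
have H (k : nat) : forall f m, (br (S k%:Z f) g)@_m = (br f g)@_(m + k%:Z).
  elim: k => [|k IH] x m; first by rewrite (aut_pow0 autS) addr0.
  rewrite -addn1 PoszD -SS IH (mpva_sesquil mbr); congr (_ @_ _); lia.
rewrite /br0; case: (intP n) => [|k|k]; first by rewrite (aut_pow0 autS).
  by rewrite H add0r.
have := H k.+1 (S (- k.+1%:Z) f) (- k.+1%:Z).
by rewrite SS subrr (aut_pow0 autS) addNr.
Qed.

Lemma is_poisson_br0 : is_poisson S br0.
Proof.
have sk n a b : br0 (S n b) a = - S n (br0 (S (- n) a) b).
  by rewrite -!mPVA_coef (mpva_skew mbr).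
split=> [a|a b|n a b].
- split=> [k b c|b c]; first exact: (mpva_linearr mbr).
  by rewrite /br0 (mpva_leibnizr mbr) [b * _]mulrC.
- by have := sk 0 a b; rewrite oppr0 !(aut_pow0 autS).
(* Skew-symmetry at lambda^n and at lambda^0 gives two expressions of {S^n b, S^n a}, whose
   comparison is equivariance. *)
- have := sk n (S n a) b; rewrite -(aut_powD autS) addNr (aut_pow0 autS).
  have := sk 0 (S n a) (S n b); rewrite oppr0 !(aut_pow0 autS) => -> /oppr_inj ->.
  by [].
Qed.

(** Every larger box works as well, so that several brackets can be compared over a common one. *)
Lemma at_lambda1_box f g : exists N0 : nat, forall N, (N0 <= N)%N ->
  at_lambda1 (br f g) = \sum_(n <- box N) br0 (S n f) g.
Proof.
exists (\max_(n <- msupp (br f g)) `|n|)%N => N le; rewrite /at_lambda1.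
under [RHS]eq_bigr do rewrite -mPVA_coef.
apply: uniq_sum_supp; rewrite ?fset_uniq ?box_uniq //.
  move=> n nS; rewrite mem_box; apply: leq_trans le.
  exact: (leq_bigmax_seq _ nS).
by move=> n _; exact: mcoeff_outdom.
Qed.
End OfMPVA.
End LocalPoisson.

(** * Existence *)

Section ShiftInvariance.
Variables (F : fieldType) (V : comAlgType F) (S : int -> V -> V).
Hypothesis autS : is_aut_powers S.

Lemma autD n a b : S n (a + b) = S n a + S n b.
Proof. by have := aut_linear autS n 1 a b; rewrite !scale1r. Qed.

Lemma aut0 n : S n 0 = 0.
Proof. by apply: (addrI (S n 0)); rewrite -autD !addr0. Qed.

Lemma autN n a : S n (- a) = - S n a.
Proof. by apply: (addrI (S n a)); rewrite -autD !subrr aut0. Qed.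

Lemma aut_sum n (I : Type) (r : seq I) (P : pred I) (G : I -> V) :
  S n (\sum_(i <- r | P i) G i) = \sum_(i <- r | P i) S n (G i).
Proof. by apply: big_morph; [exact: autD | exact: aut0]. Qed.

Lemma aut_bool n (b : bool) : S n b%:R = b%:R.
Proof. by case: b; rewrite ?(aut_one autS) ?aut0. Qed.

Variable M : int -> int -> V.
Hypothesis S_M : forall n a b, S n (M a b) = M (a + n) (b + n).

Lemma aut_quad_br n a b c d :
  S n (quad_br M a b c d) = quad_br M (a + n) (b + n) (c + n) (d + n).
Proof.
rewrite /quad_br /swap_coef /diag_coef autD !(aut_mul autS) !S_M.
by rewrite !autD !autN !aut_bool !(lerD2r n) !(ltrD2r n).
Qed.

Variable B : V -> V -> V.
Hypothesis PB : is_poisson S B.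

Lemma local_atC f g : local_at S B f g -> local_at S B g f.
Proof.
move=> [N H]; exists N => n nN; rewrite (poisson_skew PB).
have -> : B f (S n g) = S n (B (S (- n) f) g).
  by rewrite (poisson_equiv PB) -(aut_powD autS) subrr (aut_pow0 autS).
by rewrite H ?aut0 ?oppr0 //; lia.
Qed.

Lemma local_at_const f (c : F) : local_at S B f c%:A.
Proof. by exists 0%N => n _; rewrite (derC c (poisson_der PB _)). Qed.

Lemma local_atD f g h : local_at S B f g -> local_at S B f h ->
  local_at S B f (g + h).
Proof.
move=> [N H] [N' H']; exists (maxn N N') => n; rewrite gtn_max => /andP [nN nN'].
by rewrite (derD (poisson_der PB _)) H // H' // addr0.
Qed.

Lemma local_atM f g h : local_at S B f g -> local_at S B f h ->
  local_at S B f (g * h).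
Proof.
move=> [N H] [N' H']; exists (maxn N N') => n; rewrite gtn_max => /andP [nN nN'].
by rewrite (der_mul (poisson_der PB _)) H // H' // mul0r mulr0 addr0.
Qed.

End ShiftInvariance.

(** * The bracket of the generic operator of order one *)

Section GenericBracket.
Variable F : fieldType.
Local Notation V := (diffpoly F).
Local Notation Lmat := (Lmat F).
Local Notation autS := (is_aut_powers_shift F).

Definition var_br (x y : nat * int) : V :=
  quad_br Lmat x.2 (x.2 - x.1%:Z) y.2 (y.2 - y.1%:Z).

Lemma dvar_Lmat x : dvar F x = Lmat x.2 (x.2 - x.1%:Z).
Proof.
case: x => k m; rewrite Lmat_dvar /=; last by lia.
by rewrite (_ : `|(m - (m - k%:Z))%R|%N = k); last by lia.
Qed.

(** The variables are the entries with b <= a. All other entries are the constants 1 and 0, on which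
    the bracket and the quadratic expression both vanish. *)
Lemma poisson_Lmat B : is_poisson (@shift F) B ->
  (forall x y, B (dvar F x) (dvar F y) = var_br x y) ->
  forall a b c d, B (Lmat a b) (Lmat c d) = quad_br Lmat a b c d.
Proof.
move=> PB BX a b c d; have dr := poisson_der PB; have dl := poisson_derl PB.
have L1 := Lmat1 F; have L0 := @Lmat0 F.
have [ba|ab] := lerP b a; last first.
  have [->|ne] := eqVneq b (a + 1).
    rewrite (quad_br_unit L1 L0) L1; exact: der1 (dl _).
  have h : a + 1 < b by lia.
  by rewrite (quad_br_zero L0 _ _ h) (L0 _ _ h); exact: der0 (dl _).
have [dc|cd] := lerP d c; last first.
  rewrite -[RHS]opprK -quad_br_skew.
  have [->|ne] := eqVneq d (c + 1).
    by rewrite (quad_br_unit L1 L0) L1 oppr0; exact: der1 (dr _).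
  have h : c + 1 < d by lia.
  by rewrite (quad_br_zero L0 _ _ h) (L0 _ _ h) oppr0; exact: der0 (dr _).
rewrite (Lmat_dvar F ba) (Lmat_dvar F dc) BX /var_br /=.
have -> : a - `|(a - b)%R|%N%:Z = b by lia.
by have -> : c - `|(c - d)%R|%N%:Z = d by lia.
Qed.

Definition gen_br : V -> V -> V := ext_br (@der_ext F) var_br.

Lemma shift_var_br n x y :
  shift n (var_br x y) = var_br (x.1, x.2 + n) (y.1, y.2 + n).
Proof.
rewrite /var_br (aut_quad_br autS (@shift_Lmat F)) /=.
by rewrite ![_ - _ + n]addrAC.
Qed.

Lemma var_br_skew x y : var_br y x = - var_br x y.
Proof. exact: quad_br_skew. Qed.

Lemma is_poisson_gen_br : is_poisson (@shift F) gen_br.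
Proof.
exact: (@is_poisson_ext F V (@shift F) autS _ (dvar F) (@der_ext F) (@der_eq F)
  (@is_der_ext F) (@der_ext_dvar F) var_br var_br_skew
  (fun n x => (x.1, x.2 + n)) (@shift_dvar F) shift_var_br).
Qed.

Lemma gen_br_Lmat a b c d : gen_br (Lmat a b) (Lmat c d) = quad_br Lmat a b c d.
Proof.
apply: (poisson_Lmat is_poisson_gen_br) => x y; rewrite /gen_br.
rewrite (ext_brX (@der_eq F) (@is_der_ext F) (@der_ext_dvar F) var_br_skew).
exact: der_ext_dvar.
Qed.

Lemma gen_br_jacobi a b c : jacobi_at gen_br a b c.
Proof.
apply: (@ext_br_jacobi F V (@shift F) autS _ (dvar F) (@der_ext F) (@der_eq F)
  (@is_der_ext F) (@der_ext_dvar F) var_br var_br_skew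
  (fun n x => (x.1, x.2 + n)) (@shift_dvar F) shift_var_br) => i j k.
rewrite /jacobi_at !dvar_Lmat.
exact: (poisson_quad_jacobi is_poisson_gen_br gen_br_Lmat).
Qed.

Lemma gen_br_local f g : local_at (@shift F) gen_br f g.
Proof.
have PB := is_poisson_gen_br.
have L x y : local_at (@shift F) gen_br (dvar F x) (dvar F y).
  (* Beyond this bound, which has room to spare, one of the two entries lies so far along the
     diagonal that [quad_br_far] applies. *)
  exists (`|x.2| + x.1 + `|y.2| + y.1 + 5)%N => n nN.
  rewrite !dvar_Lmat shift_Lmat gen_br_Lmat; apply: (quad_br_far (@Lmat0 F)).
  by lia.
have L1 x h : local_at (@shift F) gen_br (dvar F x) h.
  elim/diffpoly_ind: h => [k|y|p q|p q].
  - exact: (local_at_const PB).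
  - exact: L.
  - exact: (local_atD PB).
  - exact: (local_atM PB).
elim/diffpoly_ind: g => [k|y|p q|p q].
- exact: (local_at_const PB).
- exact: (local_atC autS PB (L1 y f)).
- exact: (local_atD PB).
- exact: (local_atM PB).
Qed.

Lemma u_Lmat i m : shift m (u F i) = Lmat m (m + i).
Proof. by rewrite /Lmat addrAC subrr add0r. Qed.

Lemma u_Lmat0 i : u F i = Lmat 0 i.
Proof. by rewrite /Lmat subr0 (aut_pow0 autS). Qed.

Lemma gen_mPVA_exists : exists br : V -> V -> {malg V[int]},
  is_mPVA (@shift F) br /\
  (forall i j : int, i <= 0 -> j <= 0 ->
     br (u F i) (u F j) = bracket2D F i j).
Proof.
have [br [mbr brE]] := mPVA_of_poisson autS is_poisson_gen_br gen_br_jacobi gen_br_local.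
exists br; split=> [//|i j i0 j0]; apply/malgP => m.
by rewrite brE bracket2D_coef // u_Lmat u_Lmat0 gen_br_Lmat.
Qed.

Section OfMPVA.
Variable br : V -> V -> {malg V[int]}.
Hypothesis mbr : is_mPVA (@shift F) br.
Hypothesis brE : forall i j : int, i <= 0 -> j <= 0 ->
  br (u F i) (u F j) = bracket2D F i j.

(** Equivariance brings a pair of variables to the form {S^m u_i, u_j}, a coefficient of the
    prescribed bracket. Thus the values on the u_i determine the bracket of all entries. *)
Lemma br0_Lmat a b c d : br0 br (Lmat a b) (Lmat c d) = quad_br Lmat a b c d.
Proof.
have PB := is_poisson_br0 autS mbr.
apply: (poisson_Lmat PB) => x y; rewrite !dvar_Lmat.
have -> : Lmat x.2 (x.2 - x.1%:Z) = shift y.2 (shift (x.2 - y.2) (u F (- x.1%:Z))).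
  by rewrite u_Lmat shift_Lmat subrK addrAC subrK.
have -> : Lmat y.2 (y.2 - y.1%:Z) = shift y.2 (u F (- y.1%:Z)).
  by rewrite u_Lmat.
rewrite -(poisson_equiv PB) -(mPVA_coef autS mbr).
rewrite brE ?bracket2D_coef; try by lia.
rewrite (aut_quad_br autS (@shift_Lmat F)) /var_br.
by rewrite subrK addrAC subrK !add0r [- _ + y.2]addrC.
Qed.
End OfMPVA.
End GenericBracket.

(** * Matrices of pseudodifference operators *)

Section OperatorMatrix.
Variables (F : fieldType) (V : comAlgType F) (S : int -> V -> V).
Hypothesis autS : is_aut_powers S.
Implicit Types A B : pdo V.

(** In this form the product of operators is the matrix product, S is translation along the
    diagonal, and the residue is a diagonal entry. *)
Definition smat A (a b : int) : V := S a (pdo_coef A (b - a)).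

Lemma smat_top A a b : a + pdo_top A < b -> smat A a b = 0.
Proof.
by move=> h; rewrite /smat /pdo_coef ifF ?(aut0 autS) //; apply/negbTE; lia.
Qed.

Lemma smat_one a b : smat (pdo_one V) a b = (a == b)%:R.
Proof.
rewrite /smat /pdo_coef /=; case: ifP => h; last first.
  by rewrite (aut0 autS); have [e|] := eqVneq a b => //; lia.
have -> : (`|(0 - (b - a))%R|%N == 0%N) = (a == b) by lia.
exact: (aut_bool autS).
Qed.

Lemma shift_smat A n a b : S n (smat A a b) = smat A (a + n) (b + n).
Proof.
rewrite /smat -(aut_powD autS) [n + a]addrC; congr (S _ (pdo_coef _ _)); lia.
Qed.

Lemma smat_sub A B a b : smat (pdo_sub A B) a b = smat A a b - smat B a b.
Proof.
rewrite /smat -(autN autS) -(autD autS); congr (S _ _).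
set n := b - a; rewrite {1}/pdo_coef /=; set N := Num.max _ _.
have [le|gt] := lerP n N; first by congr (pdo_coef _ _ - pdo_coef _ _); lia.
rewrite /pdo_coef !ifF ?subrr //; apply/negbTE; rewrite -ltNge;
  apply: le_lt_trans gt; rewrite /N le_max lexx ?orbT //.
Qed.

Lemma smat_plus A a b :
  smat (pdo_plus A) a b = if a <= b then smat A a b else 0.
Proof.
rewrite /smat /pdo_coef /=; case: ifP => h; last first.
  by rewrite (aut0 autS) if_same.
have -> : (0 <= pdo_top A - `|(pdo_top A - (b - a))%R|%N%:Z) = (a <= b) by lia.
by case: ifP => // _; rewrite (aut0 autS).
Qed.

(** The summand vanishes unless c - [pdo_top B] <= b <= a + [pdo_top A], and the hypotheses put this
    interval inside the box. *)
Lemma smat_mul N A B a c :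
  a + pdo_top A <= N%:Z -> - N%:Z <= c - pdo_top B ->
  smat (pdo_mul S A B) a c = \sum_(b <- box N) smat A a b * smat B b c.
Proof.
move=> aN cN; rewrite {1}/smat {1}/pdo_coef /=.
have [le|gt] := lerP (c - a) (pdo_top A + pdo_top B); last first.
  rewrite (aut0 autS) big1 // => b _.
  have [/smat_top -> |h] := ltrP (a + pdo_top A) b; first by rewrite mul0r.
  by rewrite [smat B b c]smat_top ?mulr0 //; lia.
set k := absz _; rewrite (aut_sum autS).
(* The substitution b = a + [pdo_top A] - p turns the convolution of coefficients into a sum over
   matrix indices. *)
transitivity (\sum_(b <- [seq a + pdo_top A - p%:Z | p <- iota 0 k.+1])
    smat A a b * smat B b c).
  rewrite big_map -[iota 0 _]/(index_iota 0 k.+1) big_mkord; apply: eq_bigr => p _.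
  rewrite (aut_mul autS) /smat.
  have kp : (p <= k)%N by rewrite -ltnS.
  have -> : pdo_coef A (a + pdo_top A - p%:Z - a) = pdo_seq A p.
    rewrite /pdo_coef ifT; last by lia.
    by congr (pdo_seq A _); lia.
  have -> : pdo_coef B (c - (a + pdo_top A - p%:Z)) = pdo_seq B (k - p)%N.
    rewrite /pdo_coef ifT; last by lia.
    by congr (pdo_seq B _); lia.
  by rewrite -(aut_powD autS) addrA.
apply: uniq_sum_supp; rewrite ?box_uniq //.
- by rewrite map_inj_uniq ?iota_uniq // => p q; lia.
- by move=> b /mapP [p]; rewrite mem_iota mem_box => /andP [_ pk] ->; lia.
move=> b bN bk; have [h|h] := ltrP (a + pdo_top A) b.
  by rewrite smat_top ?mul0r.
have [h'|h'] := ltrP (b + pdo_top B) c; first by rewrite [X in _ * X]smat_top ?mulr0.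
case/mapP: bk; exists `|(a + pdo_top A - b)%R|%N; rewrite ?mem_iota; lia.
Qed.

(** * Powers of an operator of order at most one *)

Section Powers.
Variable A : pdo V.
Hypothesis A1 : pdo_top A = 1.
Local Notation M := (smat A).

Definition pmat n := smat (pdo_exp S A n).

Lemma pdo_top_exp n : pdo_top (pdo_exp S A n) = n%:Z.
Proof.
elim: n => [|n IH] //; rewrite /pdo_exp iterS /= -/(pdo_exp S A n) IH A1; lia.
Qed.

Lemma pmat_supp n a b : a + n%:Z < b -> pmat n a b = 0.
Proof. by move=> h; apply: smat_top; rewrite pdo_top_exp. Qed.

Lemma M_supp a b : a + 1 < b -> M a b = 0.
Proof. by move=> h; apply: smat_top; rewrite A1. Qed.

Lemma pmatS N n a c : a + 1 <= N%:Z -> - N%:Z <= c - n%:Z ->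
  pmat n.+1 a c = \sum_(b <- box N) M a b * pmat n b c.
Proof. by move=> aN cN; apply: smat_mul; rewrite ?A1 ?pdo_top_exp. Qed.

Lemma pmat_add N m n a c : a + m%:Z <= N%:Z -> - N%:Z <= c - (m + n)%N%:Z ->
  pmat (m + n) a c = \sum_(b <- box N) pmat m a b * pmat n b c.
Proof.
elim: m a => [|m IH] a aN cN.
  have E b : pmat 0 a b = (a == b)%:R by exact: smat_one.
  have [aN'|Na] := leqP `|a| N; last first.
    rewrite add0n pmat_supp ?big1_seq // => [b|]; last by lia.
    by rewrite mem_box E => bN; case: eqVneq => [ab|]; rewrite ?mul0r //; lia.
  rewrite (box_sum1 aN') ?E ?eqxx ?mul1r // => b _.
  by rewrite E eq_sym => /negbTE ->; rewrite mul0r.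
rewrite addSn (@pmatS N) //; [|lia|lia].
transitivity (\sum_(b <- box N) \sum_(b' <- box N) M a b * pmat m b b' * pmat n b' c).
  apply: eq_bigr => b _; have [h|h] := ltrP (a + 1) b.
    by rewrite M_supp // mul0r big1 // => b' _; rewrite !mul0r.
  rewrite IH; [|lia|lia].
  by rewrite mulr_sumr; apply: eq_bigr => b' _; rewrite mulrA.
rewrite exchange_big; apply: eq_big_seq => b' _.
have [h|h] := ltrP (b' + n%:Z) c.
  by rewrite [pmat n b' c]pmat_supp // mulr0 big1 // => b _; rewrite mulr0.
by rewrite -mulr_suml (@pmatS N) //; lia.
Qed.

Lemma pmat1 a b : pmat 1 a b = M a b.
Proof.
have E x y : pmat 0 x y = (x == y)%:R by exact: smat_one.
rewrite (@pmatS (`|a| + `|b| + 1)) ?(@box_sum1 _ _ _ b) ?E ?eqxx ?mulr1 //; try by lia.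
by move=> x _; rewrite E => /negbTE ->; rewrite mulr0.
Qed.

Lemma pmatSr N n a c : a + n%:Z <= N%:Z -> - N%:Z <= c - n.+1%:Z ->
  pmat n.+1 a c = \sum_(b <- box N) pmat n a b * M b c.
Proof.
move=> aN cN; rewrite -addn1 (@pmat_add N) //; last by lia.
by apply: eq_bigr => b _; rewrite pmat1.
Qed.

(** Leibniz rule for matrix powers: D(M^n) is the sum of M^p D(M) M^(n-p-1) over p < n. *)
Lemma der_pmat D N n a c : is_der D -> a + n%:Z <= N%:Z -> - N%:Z <= c - n%:Z ->
  D (pmat n a c) = \sum_(p < n) \sum_(x <- box N) \sum_(y <- box N)
     pmat p a x * D (M x y) * pmat (n - p.+1) y c.
Proof.
move=> DD; elim: n a => [|n IH] a aN cN.
  by rewrite big_ord0 /pmat smat_one der_bool.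
rewrite (@pmatS N) //; [|lia|lia].
rewrite (der_sum _ _ _ DD).
under eq_bigr do rewrite (der_mul DD).
rewrite big_split /= big_ord_recl; congr (_ + _).
  have E x y : pmat 0 x y = (x == y)%:R by exact: smat_one.
  have [aN'|Na] := leqP `|a| N; last first.
    rewrite !big1_seq // => b; rewrite mem_box /= => bN.
      rewrite big1 // => y _; rewrite E.
      by case: eqVneq => [ab|]; rewrite ?mul0r //; lia.
    have [h|h] := ltrP (a + 1) b; first by rewrite M_supp // (der0 DD) mul0r.
    by rewrite [pmat n b c]pmat_supp ?mulr0 //; lia.
  rewrite [RHS](box_sum1 aN') => [|x _].
    by apply: eq_bigr => y _; rewrite E eqxx mul1r subSS subn0.
  rewrite eq_sym => /negbTE ax; rewrite big1 // => y _.
  by rewrite E ax !mul0r.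
transitivity (\sum_(b <- box N) \sum_(p < n) \sum_(x <- box N) \sum_(y <- box N)
    M a b * pmat p b x * D (M x y) * pmat (n - p.+1) y c).
  apply: eq_big_seq => b _; have [h|h] := ltrP (a + 1) b.
    rewrite M_supp // mul0r big1 // => p _; rewrite big1 // => x _.
    by rewrite big1 // => y _; rewrite !mul0r.
  rewrite IH; [|lia|lia].
  rewrite mulr_sumr; apply: eq_bigr => p _.
  rewrite mulr_sumr; apply: eq_bigr => x _.
  by rewrite mulr_sumr; apply: eq_bigr => y _; rewrite !mulrA.
rewrite exchange_big; apply: eq_bigr => p _; rewrite exchange_big.
apply: eq_big_seq => x; rewrite mem_box => xN; rewrite exchange_big.
apply: eq_big_seq => y; rewrite mem_box => yN /=; rewrite subSS.
(* A nonzero term has x - p >= c - n, which leaves enough room in the box to sum over b. *)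
have [h|h] := ltrP (y + (n - p.+1)%N%:Z) c.
  by rewrite [pmat (n - _) y c]pmat_supp // mulr0 big1 // => b _; rewrite mulr0.
have [h'|h'] := ltrP (x + 1) y.
  by rewrite M_supp // (der0 DD) mulr0 mul0r big1 // => b _; rewrite mulr0 mul0r.
have pn := ltn_ord p.
by rewrite -!mulr_suml (@pmatS N) //; lia.
Qed.

End Powers.
End OperatorMatrix.

(** * Flows and involution *)

Section Flow.
Variables (F : fieldType) (V : comAlgType F) (S : int -> V -> V).
Hypothesis autS : is_aut_powers S.
Variable A : pdo V.
Hypothesis A1 : pdo_top A = 1.
Local Notation M := (smat S A).
Local Notation P := (pmat S A).

(** By cyclicity of the trace the n + 1 Leibniz terms are equal. The matrices are infinite, but D
    kills the relevant entries outside the box of size K, and a margin of n + 1 around it holds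
    every diagonal index involved. *)
Lemma der_trace_pmat D K N n : is_der D -> (K + n.+1 <= N)%N ->
  (forall x y : int, x <= y + n%:Z ->
     ~~ ((`|x| <= K)%N && (`|y| <= K)%N) -> D (M x y) = 0) ->
  \sum_(m <- box N) D (P n.+1 m m) =
  n.+1%:R * \sum_(x <- box K) \sum_(y <- box K) D (M x y) * P n y x.
Proof.
move=> DD KN D0.
transitivity (\sum_(m <- box N) \sum_(p < n.+1) \sum_(x <- box K) \sum_(y <- box K)
     P p m x * D (M x y) * P (n - p) y m).
  apply: eq_big_seq => m; rewrite mem_box => mN.
  rewrite (der_pmat autS A1 (N := N + n.+1) DD); [|lia|lia].
  apply: eq_bigr => p _; rewrite subSS.
  have T0 x y : ~~ ((`|x| <= K)%N && (`|y| <= K)%N) ->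
      P p m x * D (M x y) * P (n - p) y m = 0.
    move=> xy; have pn := ltn_ord p.
    have [h|h] := ltrP (m + p%:Z) x.
      by rewrite (pmat_supp autS A1 h) !mul0r.
    have [h'|h'] := ltrP (y + (n - p)%N%:Z) m.
      by rewrite (pmat_supp autS A1 h') mulr0.
    by rewrite D0 ?mulr0 ?mul0r //; lia.
  rewrite -(@box_sum_supp _ K (N + n.+1)); [|lia|].
    apply: eq_bigr => x _.
    rewrite -(@box_sum_supp _ K (N + n.+1)) //; first by lia.
    by move=> y yK; apply: T0; lia.
  by move=> x xK; rewrite big1 // => y _; apply: T0; lia.
(* With m summed innermost, M^(n-p) and M^p combine to M^n, whatever p is. *)
rewrite exchange_big /=.
rewrite -[n.+1 in RHS]card_ord mulr_natl -sumr_const; apply: eq_bigr => p _.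
rewrite exchange_big; apply: eq_big_seq => x; rewrite mem_box => xK.
rewrite exchange_big; apply: eq_big_seq => y; rewrite mem_box => yK /=.
have pn : (p <= n)%N by rewrite -ltnS.
rewrite -[n in RHS](subnK pn) (pmat_add autS A1 (N := N)); [|lia|lia].
rewrite mulr_sumr; apply: eq_bigr => m _.
by rewrite [P p m x * _]mulrC -!mulrA [P p m x * _]mulrC.
Qed.

(** With Q = (L^(n+1))_+, the condition y <= d on the first summand selects the entries of Q in (L
    Q)_cd, and c <= x those in (Q L)_cd. *)
Lemma quad_br_contract K n c d : (`|c| + `|d| + n + 2 <= K)%N ->
  \sum_(x <- box K) \sum_(y <- box K) quad_br M x y c d * P n y x
  = - smat S (pdo_comm S (pdo_plus (pdo_exp S A n.+1)) A) c d.
Proof.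
move=> hK; have Ms := M_supp autS A1.
have Ps := pmat_supp autS A1.
have topE : pdo_top (pdo_plus (pdo_exp S A n.+1)) = n.+1%:Z.
  exact: (pdo_top_exp S A1).
rewrite (smat_sub autS) (@smat_mul _ _ _ autS K) ?topE ?A1; [|lia|lia].
rewrite (@smat_mul _ _ _ autS K) ?topE ?A1; [|lia|lia].
rewrite opprB.
pose diag := \sum_(x <- box K) \sum_(y <- box K)
  diag_coef V x y c d * (M x y * M c d) * P n y x.
have diag0 : diag = 0.
  rewrite /diag; have [h|h] := ltrP (c + 1) d.
    rewrite big1 // => x _; rewrite big1 // => y _.
    by rewrite (Ms _ _ h) mulr0 mulr0 mul0r.
  (* Since d <= c + 1, the inequalities c < z and z < d exclude each other, and [diag_coef] equals
     [ind x] - [ind y]. Both parts are the trace of L^(n+1) over d <= z <= c, written as L L^n and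
     as L^n L. *)
  pose ind (z : int) : V := ((d <= z) && (z <= c))%R%:R.
  have E1 : \sum_(x <- box K) ind x * P n.+1 x x =
      \sum_(x <- box K) \sum_(y <- box K) ind x * (M x y * P n y x).
    apply: eq_bigr => x _; rewrite /ind; case: (boolP (_ && _)) => [xcd|_].
      rewrite (pmatS autS A1 (N := K)); [|lia|lia].
      by rewrite mulr_sumr.
    by rewrite mul0r big1 // => y _; rewrite mul0r.
  have E2 : \sum_(y <- box K) ind y * P n.+1 y y =
      \sum_(x <- box K) \sum_(y <- box K) ind y * (M x y * P n y x).
    rewrite exchange_big; apply: eq_bigr => y _ /=; rewrite /ind.
    case: (boolP (_ && _)) => [ycd|_].
      rewrite (pmatSr autS A1 (N := K)); [|lia|lia].
      by rewrite mulr_sumr; apply: eq_bigr => x _; rewrite [P n y x * _]mulrC.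
    by rewrite mul0r big1 // => x _; rewrite mul0r.
  transitivity (M c d *
      (\sum_(x <- box K) \sum_(y <- box K) ind x * (M x y * P n y x)
       - \sum_(x <- box K) \sum_(y <- box K) ind y * (M x y * P n y x))).
    rewrite -sumrB mulr_sumr; apply: eq_bigr => x _.
    rewrite -sumrB mulr_sumr; apply: eq_bigr => y _.
    have I (z : int) : (c < z)%R%:R + (z < d)%R%:R = 1 - ind z.
      rewrite /ind; case: (ltrP c z) => h1; case: (ltrP z d) => h2;
        rewrite ?subr0 ?subrr ?addr0 ?add0r //; lia.
    have -> : diag_coef V x y c d =
        ((c < y)%R%:R + (y < d)%R%:R) - ((c < x)%R%:R + (x < d)%R%:R).
      by rewrite /diag_coef; ring.
    by rewrite !I; ring.
  by rewrite -E1 E2 subrr mulr0.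
transitivity (\sum_(x <- box K) \sum_(y <- box K)
    swap_coef V x y c d * (M x d * M c y) * P n y x + diag).
  rewrite -big_split; apply: eq_bigr => x _; rewrite -big_split.
  by apply: eq_bigr => y _; rewrite /= -mulrDl.
rewrite diag0 addr0.
transitivity (\sum_(x <- box K) \sum_(y <- box K)
     ((y <= d)%R%:R * (M c y * (P n y x * M x d))
      - (c <= x)%R%:R * (M c y * P n y x * M x d))).
  by apply: eq_bigr => x _; apply: eq_bigr => y _; rewrite /swap_coef; ring.
under eq_bigr do rewrite sumrB.
rewrite sumrB; congr (_ - _).
  rewrite exchange_big; apply: eq_bigr => y _ /=.
  rewrite (smat_plus autS); case: ifP => yd; last first.
    by rewrite mulr0 big1 // => x _; rewrite mul0r.
  have [h|h] := ltrP (c + 1) y.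
    by rewrite (Ms _ _ h) mul0r big1 // => x _; rewrite mul0r mulr0.
  rewrite -/(P n.+1 y d) (pmatSr autS A1 (N := K)); [|lia|lia].
  by rewrite mulr_sumr; apply: eq_bigr => x _; rewrite mul1r.
apply: eq_bigr => x _.
rewrite (smat_plus autS); case: ifP => cx; last first.
  by rewrite mul0r big1 // => y _; rewrite mul0r.
rewrite -/(P n.+1 c x) (pmatS autS A1 (N := K)); [|lia|lia].
by rewrite mulr_suml; apply: eq_bigr => y _; rewrite mul1r.
Qed.

Variable br : V -> V -> {malg V[int]}.
Hypothesis mbr : is_mPVA S br.

Lemma is_der_ham f : is_der (ham_eq br f).
Proof.
have PB := is_poisson_br0 autS mbr.
have H := at_lambda1_box autS mbr f.
rewrite /ham_eq; split=> [k x y|x y].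
  have [N1 E1] := H x; have [N2 E2] := H y; have [N3 E3] := H (k *: x + y).
  pose N := maxn N1 (maxn N2 N3).
  rewrite (E1 N) ?(E2 N) ?(E3 N); try by rewrite /N; lia.
  rewrite scaler_sumr -big_split; apply: eq_bigr => m _.
  exact: (der_linear (poisson_der PB _)).
have [N1 E1] := H x; have [N2 E2] := H y; have [N3 E3] := H (x * y).
pose N := maxn N1 (maxn N2 N3).
rewrite (E1 N) ?(E2 N) ?(E3 N); try by rewrite /N; lia.
rewrite mulr_suml mulr_sumr -big_split; apply: eq_bigr => m _.
exact: (der_mul (poisson_der PB _)).
Qed.

Hypothesis BM : forall a b c d, br0 br (M a b) (M c d) = quad_br M a b c d.

(** Summing over all shifts of the residue gives the trace of L^(n+1). Differentiating it produces a
    factor n + 1, which cancels the denominator, and the two signs cancel. *)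
Lemma ham_flow n c d : n.+1%:R != 0 :> F ->
  ham_eq br (- (n.+1%:R^-1 : F) *: mRes (pdo_exp S A n.+1)) (M c d)
  = smat S (pdo_comm S (pdo_plus (pdo_exp S A n.+1)) A) c d.
Proof.
move=> n0; have PB := is_poisson_br0 autS mbr.
set k := - _; have DD := poisson_derl PB (M c d).
have [N0 E] := at_lambda1_box autS mbr (k *: mRes (pdo_exp S A n.+1)) (M c d).
(* [K] bounds the indices of entries that interact with L_cd; the trace needs n + 1 further
   places. *)
pose K := (`|c| + `|d| + n + 2)%N; pose N := maxn N0 (K + n.+1).
rewrite /ham_eq (E N) /N ?leq_maxl //.
transitivity (k *: \sum_(m <- box N) br0 br (P n.+1 m m) (M c d)).
  rewrite scaler_sumr; apply: eq_bigr => m _.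
  have -> : S m (k *: mRes (pdo_exp S A n.+1)) = k *: P n.+1 m m.
    have := aut_linear autS m k (mRes (pdo_exp S A n.+1)) 0.
    by rewrite !addr0 (aut0 autS) addr0 /pmat /smat subrr.
  exact: (derZ k _ DD).
rewrite (der_trace_pmat (K := K) DD) ?leq_maxr //; last first.
  move=> x y xy xyK; rewrite BM; apply: (quad_br_far (M_supp autS A1)).
  by rewrite /K in xyK; lia.
under eq_bigr do under eq_bigr do rewrite BM.
rewrite quad_br_contract // mulrN scalerN scaleNr opprK.
by rewrite mulr_natl -scaler_nat scalerA mulVf // scale1r.
Qed.

(** Induction on n, from D(M M^n) = [Q, M] M^n + M [Q, M^n]. *)
Lemma der_pmat_comm D Q t N n a b : is_der D -> pdo_top Q = t%:Z ->
  (forall c d, D (M c d) = smat S (pdo_comm S Q A) c d) ->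
  a + (t + n)%N%:Z <= N%:Z -> - N%:Z <= b - (t + n)%N%:Z ->
  D (P n a b) = \sum_(z <- box N) (smat S Q a z * P n z b - P n a z * smat S Q z b).
Proof.
move=> DD tQ DM; have Ms := M_supp autS A1; have Ps := pmat_supp autS A1.
have Qs x y : x + t%:Z < y -> smat S Q x y = 0.
  by move=> h; apply: (smat_top autS); rewrite tQ.
elim: n a => [|n IH] a aN bN.
  have E x y : P 0 x y = (x == y)%:R by exact: (smat_one autS).
  rewrite E der_bool // sumrB.
  have -> : \sum_(z <- box N) smat S Q a z * P 0 z b = smat S Q a b.
    have [bN'|Nb] := leqP `|b| N.
      rewrite (box_sum1 bN') ?E ?eqxx ?mulr1 // => z _ /negbTE zb.
      by rewrite E zb mulr0.
    rewrite Qs ?big1_seq //; last by lia.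
    move=> z /andP [_]; rewrite mem_box E => zN.
    by case: eqVneq => [zb|]; rewrite ?mulr0 //; lia.
  have -> : \sum_(z <- box N) P 0 a z * smat S Q z b = smat S Q a b.
    have [aN'|Na] := leqP `|a| N.
      rewrite (box_sum1 aN') ?E ?eqxx ?mul1r // => z _ /negbTE za.
      by rewrite E eq_sym za mul0r.
    rewrite Qs ?big1_seq //; last by lia.
    move=> z /andP [_]; rewrite mem_box E => zN.
    by case: eqVneq => [za|]; rewrite ?mul0r //; lia.
  by rewrite subrr.
rewrite (pmatS autS A1 (N := N)); [|lia|lia].
rewrite (der_sum _ _ _ DD).
transitivity (\sum_(z <- box N) \sum_(w <- box N)
   (smat S Q a w * (M w z * P n z b) - M a w * smat S Q w z * P n z b
    + (M a z * smat S Q z w * P n w b - M a z * P n z w * smat S Q w b))).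
  apply: eq_big_seq => z; rewrite mem_box => zN.
  rewrite (der_mul DD) big_split; congr (_ + _).
    have [h|h] := ltrP (z + n%:Z) b.
      by rewrite (Ps _ _ _ h) mulr0 big1 // => w _; rewrite !mulr0 subrr.
    rewrite DM (smat_sub autS) (@smat_mul _ _ _ autS N) ?tQ ?A1; [|lia|lia].
    rewrite (@smat_mul _ _ _ autS N) ?tQ ?A1; [|lia|lia].
    rewrite -sumrB mulr_suml; apply: eq_bigr => w _.
    by rewrite mulrBl mulrA.
  have [h|h] := ltrP (a + 1) z.
    by rewrite (Ms _ _ h) mul0r big1 // => w _; rewrite !mul0r subrr.
  rewrite IH; [|lia|lia].
  by rewrite mulr_sumr; apply: eq_bigr => w _; rewrite mulrBr !mulrA.
under eq_bigr do rewrite big_split /= !sumrB.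
rewrite big_split /= !sumrB.
(* The two copies of M Q M^n cancel. *)
rewrite [X in _ + (X - _)]exchange_big /= addrA subrK; congr (_ - _).
  rewrite exchange_big; apply: eq_bigr => w _ /=.
  have [h|h] := ltrP (a + t%:Z) w.
    by rewrite (Qs _ _ h) mul0r big1 // => z _; rewrite mul0r.
  by rewrite -mulr_sumr (pmatS autS A1 (N := N)) //; lia.
rewrite exchange_big; apply: eq_bigr => w _ /=.
have [h|h] := ltrP (w + t%:Z) b.
  by rewrite (Qs _ _ h) mulr0 big1 // => z _; rewrite mulr0.
by rewrite -mulr_suml (pmatS autS A1 (N := N)) //; lia.
Qed.

Lemma int_eq0D x y : int_eq0 S x -> int_eq0 S y -> int_eq0 S (x + y).
Proof.
by move=> [p ->] [q ->]; exists (p + q); rewrite (autD autS) opprD addrACA.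
Qed.

Lemma int_eq0Z (k : F) x : int_eq0 S x -> int_eq0 S (k *: x).
Proof.
move=> [p ->]; exists (k *: p); rewrite scalerBr.
by have := aut_linear autS 1 k p 0; rewrite (aut0 autS) !addr0 => ->.
Qed.

Lemma int_eq00 : int_eq0 S 0.
Proof. by exists 0; rewrite (aut0 autS) subrr. Qed.

Lemma int_eq0_shift n x : int_eq0 S (x - S n x).
Proof.
have H (k : nat) y : int_eq0 S (y - S k%:Z y).
  elim: k => [|k IH]; first by rewrite (aut_pow0 autS) subrr; exact: int_eq00.
  have -> : y - S k.+1%:Z y = (y - S k%:Z y) + - 1 *: (S 1 (S k%:Z y) - S k%:Z y).
    rewrite -(aut_powD autS) scaleN1r opprB addrA subrK.
    by congr (_ - S _ _).
  by apply: int_eq0D => //; apply: int_eq0Z; exists (S k%:Z y).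
case: (intP n) => [|k|k]; [exact: (H 0%N)|exact: H|].
have -> : x - S (- k.+1%:Z) x =
    - 1 *: (S (- k.+1%:Z) x - S k.+1%:Z (S (- k.+1%:Z) x)).
  by rewrite -(aut_powD autS) subrr (aut_pow0 autS) scaleN1r opprB.
exact/int_eq0Z/H.
Qed.

(** After z is replaced by - z in the second sum, its term is S^(-z) of Q_0z P_z0, the term of the
    first sum; each difference has zero integral. *)
Lemma int_eq0_pmat D Q t n : is_der D -> pdo_top Q = t%:Z ->
  (forall c d, D (M c d) = smat S (pdo_comm S Q A) c d) ->
  int_eq0 S (D (P n 0 0)).
Proof.
move=> DD tQ DM; rewrite (der_pmat_comm (N := (t + n)%N) DD tQ DM); [|lia|lia].
rewrite sumrB [X in _ - X]box_sum_opp -sumrB.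
apply: big_ind => [||z _]; [exact: int_eq00 | exact: int_eq0D |].
have -> : P n 0 (- z) * smat S Q (- z) 0 = S (- z) (smat S Q 0 z * P n z 0).
  by rewrite (aut_mul autS) !(shift_smat autS) !add0r subrr mulrC.
exact: int_eq0_shift.
Qed.

Lemma pdo_coef_smat X i : pdo_coef X i = smat S X 0 i.
Proof. by rewrite /smat subr0 (aut_pow0 autS). Qed.

Lemma ham0 g : ham_eq br 0 g = 0.
Proof.
have [N E] := at_lambda1_box autS mbr 0 g.
rewrite /ham_eq (E N) // big1 // => n _; rewrite (aut0 autS).
exact: der0 (poisson_derl (is_poisson_br0 autS mbr) g).
Qed.

Lemma smat_comm_one a b :
  smat S (pdo_comm S (pdo_plus (pdo_exp S A 0)) A) a b = 0.
Proof.
have E x y : smat S (pdo_plus (pdo_exp S A 0)) x y = (x == y)%:R.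
  rewrite (smat_plus autS) (smat_one autS).
  by case: (ltgtP x y) => // ->.
pose N := (`|a| + `|b| + 2)%N.
rewrite (smat_sub autS) !(@smat_mul _ _ _ autS N) ?A1 /N //=; try by lia.
rewrite (box_sum1 (n := a)) ?E ?eqxx ?mul1r; first last.
- by move=> z _ /negbTE za; rewrite E eq_sym za mul0r.
- by lia.
rewrite (box_sum1 (n := b)) ?E ?eqxx ?mulr1 ?subrr //; first by lia.
by move=> z _ /negbTE zb; rewrite E zb mulr0.
Qed.

(** For the generic operator [L F] this is convertible to [h F n]. *)
Definition res_ham (n : nat) : V :=
  if n == 0%N then 0 else - (n%:R^-1 : F) *: mRes (pdo_exp S A n).

Hypothesis F0 : [pchar F] =i pred0.

Lemma ham_flow_coef n i : ham_eq br (res_ham n) (pdo_coef A i)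
  = pdo_coef (pdo_comm S (pdo_plus (pdo_exp S A n)) A) i.
Proof.
rewrite !pdo_coef_smat; case: n => [|n]; first by rewrite ham0 smat_comm_one.
by rewrite ham_flow // ((pcharf0P _).1 F0).
Qed.

Lemma res_ham_involution : in_involution S br res_ham.
Proof.
move=> m n; rewrite -/(ham_eq br (res_ham m) (res_ham n)).
have DD f := is_der_ham f.
case: m => [|m]; first by rewrite ham0; exact: int_eq00.
case: n => [|n]; first by rewrite (der0 (DD _)); exact: int_eq00.
rewrite [res_ham n.+1]/res_ham /= (derZ _ _ (DD _)); apply: int_eq0Z.
rewrite /mRes pdo_coef_smat -/(P n.+1).
apply: (@int_eq0_pmat _ (pdo_plus (pdo_exp S A m.+1)) m.+1 n.+1 (DD _)).
  exact: (pdo_top_exp S A1).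
by move=> c d; rewrite ham_flow // ((pcharf0P _).1 F0).
Qed.

End Flow.

(** * Independence of the Hamiltonians *)

Section Independence.
Variable F : fieldType.
Local Notation V := (diffpoly F).
Local Notation autS := (is_aut_powers_shift F).

Lemma pdo_coef_L i : pdo_coef (L F) i = u F i.
Proof.
rewrite /pdo_coef [pdo_top _]/=; case: ifP => h.
  have {2}-> : i = 1 - `|(1 - i)%R|%N%:Z by lia.
  by [].
by rewrite u_gt1 //; lia.
Qed.

Lemma smat_L a b : smat (@shift F) (L F) a b = Lmat F a b.
Proof. by rewrite /smat pdo_coef_L. Qed.

(* Kills the image of S - 1, since it forgets all shifts; the symbol of L
   becomes z + t. *)
Definition ev : V -> {poly F} :=
  subst (@polyC F) (fun x => if x.1 == 0%N then 'X else 0).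

Lemma evD p q : ev (p + q) = ev p + ev q.
Proof. exact: (rmorphD (subst _ _)). Qed.

Lemma evM p q : ev (p * q) = ev p * ev q.
Proof. exact: (rmorphM (subst _ _)). Qed.

Lemma ev1 : ev 1 = 1.
Proof. exact: (rmorph1 (subst _ _)). Qed.

Lemma ev0 : ev 0 = 0.
Proof. exact: (rmorph0 (subst _ _)). Qed.

Lemma evC c : ev c%:A = c%:P.
Proof. exact: substC. Qed.

Lemma evX x : ev (dvar F x) = if x.1 == 0%N then 'X else 0.
Proof. exact: subst_dvar. Qed.

Lemma evZ c p : ev (c *: p) = c *: ev p.
Proof. by rewrite -mulr_algl evM evC mul_polyC. Qed.

Lemma ev_sum (I : Type) (r : seq I) (G : I -> V) :
  ev (\sum_(i <- r) G i) = \sum_(i <- r) ev (G i).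
Proof. exact: (big_morph ev evD ev0). Qed.

Lemma ev_shift n p : ev (shift n p) = ev p.
Proof.
elim/diffpoly_ind: p => [c|x|p q Hp Hq|p q Hp Hq].
- by rewrite shiftC.
- by rewrite shift_dvar; exact: etrans (evX (x.1, x.2 + n)) (esym (evX x)).
- rewrite shiftD; apply: etrans (evD _ _) (etrans _ (esym (evD p q))).
  exact: (congr2 +%R Hp Hq).
- rewrite shiftM; apply: etrans (evM _ _) (etrans _ (esym (evM p q))).
  exact: (congr2 *%R Hp Hq).
Qed.

Lemma ev_Lmat a b :
  ev (Lmat F a b) = if b == a + 1 then 1 else if b == a then 'X else 0.
Proof.
rewrite /Lmat ev_shift /u; case: ifP => h.
  rewrite evX [RHS]ifF /=; last by lia.
  by have -> : (`|(b - a)%R|%N == 0%N) = (b == a) by lia.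
case: ifP => h1; first by rewrite ev1 ifT //; lia.
by rewrite ev0 !ifF //; lia.
Qed.

(** Only z = a and z = a + 1 can contribute, and the latter does not, as a + 1 > b puts it strictly
    below the diagonal of Y. *)
Lemma box_sum_bidiag (R : comNzRingType) N (X Y : int -> R) (t : R) a b n :
  (forall z, X z = if z == a + 1 then 1 else if z == a then t else 0) ->
  (forall z, b <= z -> Y z = if z == b then t ^+ n else 0) ->
  b <= a -> (`|a| <= N)%N ->
  \sum_(z <- box N) X z * Y z = if a == b then t ^+ n.+1 else 0.
Proof.
move=> EX EY ba aN; rewrite (box_sum1 aN) => [|z _ za].
  rewrite EX EY // eqxx ifF; last by lia.
  by case: eqVneq => _; rewrite ?mulr0 // -exprS.
rewrite EX (negbTE za); case: eqVneq => [e|_]; last by rewrite mul0r.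
by rewrite EY ?ifF ?mulr0 //; lia.
Qed.

(** The powers of z + t are tracked only on and below the diagonal, which suffices for the residue
    t^n. *)
Lemma ev_pmat n a b : b <= a ->
  ev (pmat (@shift F) (L F) n a b) = if a == b then 'X^n else 0.
Proof.
have L1 : pdo_top (L F) = 1 by [].
elim: n a => [|n IH] a ba.
  have -> : pmat (@shift F) (L F) 0 a b = (a == b)%:R by exact: (smat_one autS).
  by case: eqVneq => _; rewrite ?ev1 ?ev0.
rewrite (pmatS autS L1 (N := (`|a| + `|b| + n + 1)%N)); [|lia|lia].
rewrite ev_sum.
have E z : ev (smat (@shift F) (L F) a z * pmat (@shift F) (L F) n z b)
    = ev (Lmat F a z) * ev (pmat (@shift F) (L F) n z b).
  by apply: etrans (evM _ _) _; rewrite smat_L.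
rewrite (eq_bigr _ (fun z _ => E z)).
apply: (@box_sum_bidiag _ _ (fun z => ev (Lmat F a z))
  (fun z => ev (pmat (@shift F) (L F) n z b)) 'X) => // [z|]; last by lia.
exact: ev_Lmat.
Qed.

Lemma res_ham_linindep : [pchar F] =i pred0 ->
  int_linindep (@shift F) (fun n => h F n.+1).
Proof.
move=> F0 N c [p hp] n.
have : ev (\sum_(k < N) c k *: h F k.+1) = 0.
  by rewrite hp -scaleN1r evD evZ ev_shift scaleN1r subrr.
have hE k : ev (h F k.+1) = - (k.+1%:R^-1) *: 'X^(k.+1).
  have -> : h F k.+1 = - (k.+1%:R^-1 : F) *: pmat (@shift F) (L F) k.+1 0 0.
    by rewrite /pmat -(pdo_coef_smat autS).
  by rewrite evZ ev_pmat // eqxx.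
(* The image of h_(k+1) is a nonzero multiple of t^(k+1), so the coefficient of t^(n+1) isolates
   c_n. *)
rewrite ev_sum => /(congr1 (fun q : {poly F} => q`_n.+1)).
rewrite coef0 coef_sum (bigD1 n) //= big1 => [|k kn].
  rewrite evZ hE !coefZ coefXn eqxx mulr1 addr0 => /eqP.
  rewrite mulf_eq0 oppr_eq0 invr_eq0 ((pcharf0P _).1 F0) orbF.
  by move/eqP.
rewrite evZ hE !coefZ coefXn eqSS (_ : (n == k :> nat) = false) ?mulr0 //.
by apply/negbTE; rewrite eq_sym.
Qed.

End Independence.

Theorem theorem9p5 (F : fieldType) (F0 : [pchar F] =i pred0) :
  (exists br : diffpoly F -> diffpoly F -> {malg (diffpoly F)[int]},
     is_mPVA (@shift F) br /\
     (forall i j : int, i <= 0 -> j <= 0 ->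
        br (u F i) (u F j) = bracket2D F i j)) /\
  (forall br : diffpoly F -> diffpoly F -> {malg (diffpoly F)[int]},
     is_mPVA (@shift F) br ->
     (forall i j : int, i <= 0 -> j <= 0 ->
        br (u F i) (u F j) = bracket2D F i j) ->
     (forall (n : nat) (i : int),
        ham_eq br (h F n) (pdo_coef (L F) i)
        = pdo_coef (pdo_comm (@shift F)
            (pdo_plus (pdo_exp (@shift F) (L F) n)) (L F)) i) /\
     integrable_hierarchy (@shift F) br (h F)).
Proof.
split=> [|br mbr brE]; first exact: gen_mPVA_exists.
have autS := is_aut_powers_shift F.
have L1 : pdo_top (L F) = 1 by [].
(* From here on the bracket enters only through the mPVA axioms and this formula on the entries of
   L. *)
have BM a b c d : br0 br (smat (@shift F) (L F) a b) (smat (@shift F) (L F) c d)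
    = quad_br (smat (@shift F) (L F)) a b c d.
  by rewrite /quad_br !smat_L; exact: (br0_Lmat mbr brE).
split=> [n i|]; first exact: (ham_flow_coef autS L1 mbr BM F0).
split; first exact: (res_ham_involution autS L1 mbr BM F0).
exact: res_ham_linindep.
Qed.
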